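(* If $S$ is a Buchsbaum simplicial poset of dimension $n-1$, then $h''_i(S)\geqslant 0$ for all $0\leqslant i\leqslant n$.
   Context: The ground ring $\Bbbk$ is a field or $\mathbb Z$; all homology is with coefficients in $\Bbbk$; $\dim$ of a $\Bbbk$-module means its rank. A finite poset $S$ is simplicial if it has a least element $\varnothing$ and every lower interval $S_{\leqslant I}$ is isomorphic to a Boolean lattice $2^{[k]}$; then $|I|=k$, $\dim I=|I|-1$. $|S|$ is the geometric realization of the order complex of $S\setminus\{\varnothing\}$, and $H_*(S)=H_*(|S|)$. For $I\in S$, $\mathrm{lk}_SI=\{J\in S\mid J\geqslant I\}$, a simplicial poset with least element $I$. $S$ with $\dim S=n-1$ is Buchsbaum (over $\Bbbk$) if $\widetilde H_i(\mathrm{lk}_SI)=0$ for all $\varnothing\neq I\in S$ and $i\neq n-1-|I|$. Face numbers. $f_i$ is the number of $I\in S$ with $\dim I=i$, $f_{-1}=1$; $\sum_{i=0}^nh_it^i=\sum_{i=0}^nf_{i-1}t^i(1-t)^{n-i}$; with $\widetilde b_i=\dim\widetilde H_i(S)$, $$h'_i=h_i+\binom ni\sum_{j=1}^{i-1}(-1)^{i-j-1}\widetilde b_{j-1}\ (0\leqslant i\leqslant n),\qquad h''_i=h'_i-\binom ni\widetilde b_{i-1}=h_i+\binom ni\sum_{j=1}^{i}(-1)^{i-j-1}\widetilde b_{j-1}\ (0\leqslant i\leqslant n-1),\qquad h''_n=h'_n.$$ *)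

(* Defs.v *)
From mathcomp Require Import all_boot all_order all_algebra.
From mathcomp Require Import boolp.

Set Implicit Arguments.
Unset Strict Implicit.
Unset Printing Implicit Defensive.

Import Order.TTheory GRing.Theory Num.Theory.
Local Open Scope ring_scope.

(* The homology of the geometric realization of an order complex is taken to be
   its simplicial homology, vertices being oriented by the poset order. *)

Section OrderComplexHomology.
Variables (k : idomainType) (d : Order.disp_t) (T : finPOrderType d).
Implicit Types (A s t : {set T}) (i : int).

(* Simplices of the order complex of A, including the empty one. *)
Definition order_complex A : {set {set T}} :=
  [set s : {set T} | (s \subset A) &&
     [forall x in s, forall y in s, (x <= y)%O || (y <= x)%O]].

(* A chain of any degree is a k-valued function on subsets of T; [is_chain A i]
   singles out those supported on the i-simplices of the order complex of A.
   The empty simplex has dimension -1, so that the resulting homology is the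
   reduced one, with value k in degree -1 when A is empty. *)
Definition is_chain A i (c : {ffun {set T} -> k^o}) : Prop :=
  forall s, c s != 0 -> s \in order_complex A /\ #|s|%:Z = i + 1.

(* For a simplex x_0 < ... < x_p, the coefficient of the face omitting x_j is
   (-1)^j; the exponent below is the position j of x in t with x added. *)
Definition boundary (c : {ffun {set T} -> k^o}) : {ffun {set T} -> k^o} :=
  [ffun t : {set T} => \sum_(x | x \notin t)
     (-1) ^+ #|[set y in t | (y < x)%O]| * c (x |: t)].

Definition is_cycle A i z : Prop := is_chain A i z /\ boundary z = 0.

Definition is_boundary A i z : Prop :=
  exists2 c, is_chain A (i + 1) c & boundary c = z.

Definition homology_vanishes A i : Prop :=
  forall z, is_cycle A i z -> is_boundary A i z.

(* r cycles whose homology classes are linearly independent over k *)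
Definition has_indep_classes A i (r : nat) : Prop :=
  exists2 z : 'I_r -> {ffun {set T} -> k^o},
    (forall j, is_cycle A i (z j)) &
    forall a : 'I_r -> k,
      is_boundary A i (\sum_(j < r) a j *: z j) -> forall j, a j = 0.

(* The rank over k of the reduced homology in degree i: the largest size of a
   linearly independent family. The bound on r loses nothing, chains forming a
   free module of rank #|{set T}|. *)
Definition betti A i : nat :=
  \max_(r < #|{set T}|.+1 | `[< has_indep_classes A i r >]) r.

End OrderComplexHomology.

Section SimplicialPoset.
Variables (d : Order.disp_t) (S : finBPOrderType d).
Implicit Types I J : S.

(* [phi] is an isomorphism from the Boolean lattice 2^[m] onto the lower
   interval of I. *)
Definition boolean_lower_interval I (m : nat) : bool :=
  [exists phi : {ffun {set 'I_m} -> S},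
    [forall A : {set 'I_m}, forall B : {set 'I_m},
        (phi A <= phi B)%O == (A \subset B)] &&
    [forall J : S, (J <= I)%O == [exists A : {set 'I_m}, phi A == J]]].

Definition simplicial_poset : Prop :=
  forall I, exists m, boolean_lower_interval I m.

Definition link I : {set S} := [set J | (I <= J)%O].

Section Numbers.
Hypothesis hS : simplicial_poset.

(* |I|: the unique m such that the lower interval of I is isomorphic to 2^[m] *)
Definition face_card I : nat := xchoose (hS I).

Definition face_dim I : int := (face_card I)%:Z - 1.

Definition poset_dim : int := (\max_(I : S) face_card I)%:Z - 1.

Definition f_num (i : int) : nat := #|[set I | face_dim I == i]|.

Definition h_poly (n : nat) : {poly int} :=
  \sum_(i < n.+1) (f_num (i%:Z - 1))%:Z *: ('X^i * (1 - 'X) ^+ (n - i)).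

Definition h_num (n i : nat) : int := (h_poly n)`_i.

Variable k : idomainType.

Definition buchsbaum : Prop :=
  forall I, I != \bot%O -> forall i : int,
    i <> poset_dim - (face_card I)%:Z -> homology_vanishes k (link I :\ I) i.

Definition poset_betti (i : int) : nat := betti k ([set: S] :\ \bot%O) i.

Definition h_prime (n i : nat) : int :=
  h_num n i + 'C(n, i)%:Z *
    \sum_(1 <= j < i) (-1) ^+ (i - j - 1) * (poset_betti (j%:Z - 1))%:Z.

(* In degree i = 0 < n the subtracted Betti number is that of degree -1, which
   is zero since S has faces other than \bot. *)
Definition h_second (n i : nat) : int :=
  if i == n then h_prime n n
  else h_prime n i - 'C(n, i)%:Z * (poset_betti (i%:Z - 1))%:Z.

End Numbers.
End SimplicialPoset.

Arguments buchsbaum {d S} hS k.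
Arguments poset_betti {d} S k i.

(* Main.v *)
(* Everything takes place over the infinite field K = Frac(k[X]), to which
   the hypotheses and the Betti numbers transfer by clearing denominators. Give
   the vertices pairwise distinct points of K and let lambda_v in K^n be the
   corresponding points of the moment curve, so that any n of them are linearly
   independent. For r = n - i, let G(I) be the subspace of the exterior power
   Lambda^r(K^n) killed by the contractions with all lambda_v, v a vertex of I.
   Since dim G(I) = binom(n - |I|, r), the alternating sum of the dimensions of
   the spaces of chains of the order complex of S \ {0} with coefficient at a
   chain taken in G(top of the chain) is h_i, up to sign. An induction on r and
   on the set of vertices, which starts from the acyclicity of the open stars
   (the Buchsbaum condition), shows that Lambda^r(K^n)/G has no homology in low
   degrees. Comparing with constant coefficients in Lambda^r(K^n), whose
   homology has rank binom(n, i) times a Betti number, exhibits h''_i (i < n)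
   as the dimension of the space of boundaries, with constant coefficients,
   that lie in G. *)
From HB Require Import structures.
Require Import Defs.
From mathcomp Require Import all_boot all_order all_algebra.
From mathcomp Require Import boolp zify.

Set Implicit Arguments.
Unset Strict Implicit.
Unset Printing Implicit Defensive.

Import Order.TTheory GRing.Theory Num.Theory.
Local Open Scope ring_scope.

(** * Boundary of module-valued chains *)

(** Everything rests on the exact sequence 0 -> ann_{r+1}(T + v) -> ann_{r+1}(T) -> ann_r(T + v) ->
    0, whose second map is contraction with lambda_v; it holds when T + v has at most n elements. It
    trades a condition for an exterior degree: to impose the vertex v on a chain, contract it with
    lambda_v, bound the result in degree r and lift back. The contraction concerns only simplices
    having v among their vertices, which is why open stars appear. Contracting a bounding chain
    raises the size j by one and lowers r by one, so that [j + r] is preserved; hence the ranges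
    [j + r < n] and [j + r <= n].

    For r = n - i the second range is j <= i, which is also where the coefficients stop: a simplex
    with more than i elements has more than i vertices, and G is zero on it. So the alternating sum
    can be truncated at i, and the truncation leaves one term that does not telescope away.

    Several faces of a simplicial poset may share their vertex set W, so the open star of W is not
    governed by a single link; its acyclicity is derived from those of the links by a discrete Morse
    matching. *)

Section Boundary.
Variables (R : nzRingType) (d : Order.disp_t) (T : finPOrderType d).
Implicit Types (s t A : {set T}) (x : T).

Definition position t x := #|[set y in t | (y < x)%O]|.

Definition bd (M : lmodType R) (z : {set T} -> M) t : M :=
  \sum_(x | x \notin t) (-1) ^+ position t x *: z (x |: t).

Lemma eq_bd (M : lmodType R) (z z' : {set T} -> M) t :
  (forall x, x \notin t -> z (x |: t) = z' (x |: t)) -> bd z t = bd z' t.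
Proof. by move=> e; apply: eq_bigr => x xt; rewrite e. Qed.

Lemma bd_eq0 (M : lmodType R) (z : {set T} -> M) t :
  (forall x, x \notin t -> z (x |: t) = 0) -> bd z t = 0.
Proof. by move=> e; apply: big1 => x xt; rewrite e // scaler0. Qed.

Lemma bd_neq0 (M : lmodType R) (z : {set T} -> M) t :
  bd z t != 0 -> exists2 x, x \notin t & z (x |: t) != 0.
Proof.
move=> h; apply: contrapT => nex; move/negP: h; apply; apply/eqP.
by apply: bd_eq0 => x xt; apply: contrapT => /eqP zx; apply: nex; exists x.
Qed.

Lemma bdD (M : lmodType R) (z z' : {set T} -> M) t :
  bd (fun s => z s + z' s) t = bd z t + bd z' t.
Proof. by rewrite -big_split; apply: eq_bigr => x _; rewrite scalerDr. Qed.

Lemma linear_bd (M M' : lmodType R) (f : {linear M -> M'}) (z : {set T} -> M) t :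
  f (bd z t) = bd (fun s => f (z s)) t.
Proof. by rewrite linear_sum; apply: eq_bigr => x _; rewrite linearZ. Qed.

Lemma bdN (M : lmodType R) (z : {set T} -> M) t :
  bd (fun s => - z s) t = - bd z t.
Proof. by rewrite -sumrN; apply: eq_bigr => x _; rewrite scalerN. Qed.

Lemma bdB (M : lmodType R) (z z' : {set T} -> M) t :
  bd (fun s => z s - z' s) t = bd z t - bd z' t.
Proof. by rewrite -bdN -bdD. Qed.

Lemma bd_sum (M : lmodType R) (I : finType) (P : pred I)
    (z : I -> {set T} -> M) t :
  bd (fun s => \sum_(i | P i) z i s) t = \sum_(i | P i) bd (z i) t.
Proof.
by rewrite exchange_big; apply: eq_bigr => x _; rewrite scaler_sumr.
Qed.

Lemma position_setU1 t x y : x \notin t -> y \notin t -> (x < y)%O ->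
  (position (x |: t) y = (position t y).+1) * (position (y |: t) x = position t x).
Proof.
move=> xt yt xy; split; rewrite /position.
  rewrite (cardsD1 x) !inE eqxx xy /= add1n; congr _.+1.
  apply: eq_card => w; rewrite !inE.
  by case: eqP => [->|_] /=; rewrite ?(negPf xt).
apply: eq_card => w; rewrite !inE.
by case: eqP => [->|] //=; rewrite (negPf yt) lt_gtF.
Qed.

(** The terms adding x < y to [t] in the two orders cancel: x shifts the position of y, while y does
    not shift that of x. Incomparable x and y would not cancel, hence the condition on the
    support. *)
Lemma bd_bd (M : lmodType R) (z : {set T} -> M) t :
  (forall s, z s != 0 -> s \in order_complex [set: T]) -> bd (bd z) t = 0.
Proof.
move=> zP.
pose F x y := (-1) ^+ position t x *: ((-1) ^+ position (x |: t) y *: z (y |: (x |: t))).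
have -> : bd (bd z) t = \sum_(x | x \notin t) \sum_(y | y \notin t)
    ((if (x < y)%O then F x y else 0) + (if (y < x)%O then F x y else 0)).
  apply: eq_bigr => x xt; rewrite scaler_sumr (bigID (fun y => y \notin t)) /=.
  rewrite [X in _ + X]big1 ?addr0; last first.
    by move=> y; rewrite !inE negb_or => /andP[/andP[_ ->]].
  rewrite [RHS](bigD1 x) //= !ltxx addr0 add0r.
  apply: eq_big => [y|y]; first by rewrite !inE negb_or -andbA andbb andbC.
  rewrite !inE negb_or -andbA => /and3P[yx yt _]; rewrite -/(F x y).
  have [xy|yx'|xy|exy] := comparableP x y; rewrite ?addr0 ?add0r //.
    apply: contrapT => /eqP F0. have : z (y |: (x |: t)) != 0.
      by apply: contra_neq F0 => e; rewrite /F e !scaler0.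
    move/zP; rewrite inE => /andP[_ /forall_inP/(_ x)].
    rewrite !inE eqxx orbT => /(_ isT)/forall_inP/(_ y).
    by rewrite !inE eqxx => /(_ isT); rewrite -/(x >=< y)%O (negPf xy).
  by rewrite exy eqxx in yx.
under eq_bigr do rewrite big_split /=.
rewrite big_split /= [X in _ + X]exchange_big -big_split big1 //= => x xt.
rewrite -big_split big1 //= => y yt; case: ifP => xy; last by rewrite addr0.
rewrite /F !(position_setU1 xt yt xy) setUCA exprS mulN1r scaleNr scalerN.
by rewrite !scalerA addrC; apply/eqP; rewrite subr_eq0 -!exprD addnC.
Qed.

End Boundary.

(** * Exterior powers *)

Section Exterior.
Variable K : fieldType.
Implicit Types (x f : nat -> K) (n r : nat).

(** Splits off the first basis vector e_0: the pair (a, b) stands for a + e_0 /\ b, with a and b in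
    the exterior algebra on the other coordinates. [contract] and [wedge] are the usual operations
    written in this decomposition. *)
Fixpoint ext n : nat -> vectType K :=
  if n is n'.+1 then
    fun r => if r is r'.+1 then (ext n' r'.+1 * ext n' r')%type else ext n' 0
  else fun r => if r is 0 then K^o else 'rV[K]_0.

Fixpoint contract n x : forall r, ext n r.+1 -> ext n r :=
  match n return forall r, ext n r.+1 -> ext n r with
  | 0 => fun _ _ => 0
  | n'.+1 => fun r =>
    match r return ext n'.+1 r.+1 -> ext n'.+1 r with
    | 0 => fun p : ext n' 1 * ext n' 0 =>
        contract (x \o S) p.1 + x 0%N *: p.2
    | r'.+1 => fun p : ext n' r'.+2 * ext n' r'.+1 =>
        (contract (x \o S) p.1 + x 0%N *: p.2, - contract (x \o S) p.2)
    end
  end.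

Fixpoint wedge n f : forall r, ext n r -> ext n r.+1 :=
  match n return forall r, ext n r -> ext n r.+1 with
  | 0 => fun _ _ => 0
  | n'.+1 => fun r =>
    match r return ext n'.+1 r -> ext n'.+1 r.+1 with
    | 0 => fun a : ext n' 0 => (wedge (f \o S) a, f 0%N *: a)
    | r'.+1 => fun p : ext n' r'.+1 * ext n' r' =>
        (wedge (f \o S) p.1, f 0%N *: p.1 - wedge (f \o S) p.2)
    end
  end.

Lemma contract_is_linear n x r : linear (@contract n x r).
Proof.
elim: n x r => [|n IHn] x [|r] a u v /=; rewrite ?scaler0 ?addr0 //.
  by rewrite IHn scalerDr scalerDr !scalerA mulrC addrACA.
congr pair => /=; last by rewrite IHn opprD scalerN.
by rewrite IHn scalerDr scalerDr !scalerA mulrC addrACA.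
Qed.

HB.instance Definition _ n x r :=
  GRing.isLinear.Build K (ext n r.+1) (ext n r) _ _ (@contract_is_linear n x r).

Lemma wedge0 n f r : @wedge n f r 0 = 0.
Proof.
elim: n f r => [|n IHn] f [|r] //=.
  by rewrite IHn scaler0.
by rewrite !IHn scaler0 subr0.
Qed.

Lemma wedge_is_linear n f r : linear (@wedge n f r).
Proof.
elim: n f r => [|n IHn] f [|r] a u v /=; rewrite ?scaler0 ?addr0 //.
  by congr pair => /=; rewrite ?IHn // scalerDr !scalerA mulrC.
congr pair => /=; rewrite IHn // scalerDr !scalerA mulrC opprD scalerBr.
by rewrite scalerA addrACA.
Qed.

HB.instance Definition _ n f r :=
  GRing.isLinear.Build K (ext n r) (ext n r.+1) _ _ (@wedge_is_linear n f r).

Definition pair_at n x f : K := \sum_(i < n) f i * x i.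

Lemma pair_atS n x f :
  pair_at n.+1 x f = f 0%N * x 0%N + pair_at n (x \o S) (f \o S).
Proof. by rewrite /pair_at big_ord_recl. Qed.

Lemma contract_wedge0 n x f (a : ext n 0) :
  contract x (wedge f a) = pair_at n x f *: a.
Proof.
elim: n x f a => [|n IHn] x f a /=; first by rewrite /pair_at big_ord0 scale0r.
by rewrite IHn pair_atS scalerDl scalerA addrC mulrC.
Qed.

(** Contraction is an antiderivation. If x kills [a], only the pairing remains, so wedging with a
    vector dual to x is a right inverse of the contraction. *)
Lemma contract_wedge n x f r (a : ext n r.+1) :
  contract x (wedge f a) + wedge f (contract x a) = pair_at n x f *: a.
Proof.
elim: n x f r a => [|n IHn] x f [|r] a.
- by rewrite /= /pair_at big_ord0 scale0r addr0.
- by rewrite /= /pair_at big_ord0 scale0r addr0.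
- case: a => a b /=; rewrite pair_atS; congr pair => /=.
    rewrite ?linearD ?linearZ /= scalerN addrACA subrK IHn scalerA.
    by rewrite scalerDl addrC.
  rewrite linearB linearZ /= contract_wedge0 opprB scalerDr scalerA addrA subrK.
  by rewrite scalerDl addrC.
- case: a => a b /=; rewrite pair_atS; congr pair => /=.
    rewrite ?linearD ?linearZ /= scalerN addrACA subrK IHn scalerA.
    by rewrite scalerDl addrC.
  rewrite linearB linearZ linearN /= opprB scalerDr scalerA opprK.
  by rewrite 2!addrA subrK addrAC IHn scalerDl addrC.
Qed.

Lemma contract_anti n x y r (a : ext n r.+2) :
  contract x (contract y a) = - contract y (contract x a).
Proof.
elim: n x y r a => [|n IHn] x y [|r] a; rewrite /= ?oppr0 //; case: a => a b /=.
  by rewrite !linearD !linearZ /= IHn !scalerN opprK addrAC.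
have oppr_pair (U V : vectType K) (u : U) (v : V) :
  - ((u, v) : (U * V)%type) = (- u, - v) by [].
rewrite oppr_pair; congr pair.
  by rewrite !linearD !linearZ /= IHn !scalerN opprK addrAC.
by rewrite ![contract _ (- _)]linearN /= !opprK IHn.
Qed.

Lemma contract_sq n x r (a : ext n r.+2) : contract x (contract x a) = 0.
Proof.
elim: n x r a => [|n IHn] x [|r] a //; case: a => a b /=.
  by rewrite linearD linearZ /= IHn add0r scalerN subrr.
rewrite linearD linearZ /= IHn add0r scalerN subrr; congr pair => /=.
by rewrite linearN /= IHn !oppr0.
Qed.

Lemma dim_prod (U V : vectType K) :
  \dim {: (U * V)%type} = (\dim {:U} + \dim {:V})%N.
Proof. by rewrite !dimvf. Qed.

Lemma dim_ext n r : \dim {: ext n r} = 'C(n, r).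
Proof.
elim: n r => [|n IHn] [|r] /=; rewrite ?dimvf //=.
  by rewrite -dimvf IHn !bin0.
by rewrite -dimvf dim_prod !IHn.
Qed.

End Exterior.

(** * Annihilators of points of the moment curve *)

Section Annihilator.
Variables (K : fieldType) (n : nat) (V : finType) (pt : V -> K).
Hypothesis pt_inj : injective pt.
Implicit Types (u v : V) (U T : {set V}).

Definition moment v (i : nat) : K := pt v ^+ i.

(** In degree 0 contractions land in degree -1, which is zero, so no condition is imposed. *)
Definition ann r U : {vspace ext K n r} :=
  match r with
  | 0 => fullv
  | r'.+1 => \bigcap_(u in U) lker (linfun (@contract K n (moment u) r'))
  end.

Lemma annP r U (a : ext K n r.+1) :
  reflect (forall u, u \in U -> contract (moment u) a = 0) (a \in ann r.+1 U).
Proof.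
rewrite memvE; apply: (iffP subv_bigcapP) => h u uU.
  by have := h u uU; rewrite -memvE memv_ker lfunE => /eqP.
by rewrite -memvE memv_ker lfunE; apply/eqP/h.
Qed.

Lemma annS r U T (a : ext K n r) : U \subset T -> a \in ann r T -> a \in ann r U.
Proof.
move=> /subsetP UT; case: r a => [|r] a; first by rewrite !memvf.
by move/annP=> h; apply/annP => u /UT /h.
Qed.

Lemma ann_contract r v T (a : ext K n r.+1) :
  a \in ann r.+1 T -> contract (moment v) a \in ann r (v |: T).
Proof.
case: r a => [|r] a; first by rewrite !memvf.
move/annP=> h; apply/annP => u; rewrite !inE => /orP[/eqP ->|/h e].
  exact: contract_sq.
by rewrite contract_anti e linear0 oppr0.
Qed.

(** Pairing with a point of the moment curve evaluates the polynomial of degree < n with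
    coefficients f. Lagrange interpolation gives f: the product of the ['X - pt u] over T,
    normalized at [pt v]. *)
Lemma dual_functional v T : v \notin T -> (#|T| < n)%N ->
  exists f, pair_at n (moment v) f = 1 /\
    forall u, u \in T -> pair_at n (moment u) f = 0.
Proof.
move=> vT Tn; pose p := \prod_(u <- enum T) ('X - (pt u)%:P).
have hp (q : {poly K}) u : (size q <= n)%N ->
    pair_at n (moment u) (fun i => q`_i) = q.[pt u].
  by move=> sq; rewrite (horner_coef_wide _ sq).
have p0 : p.[pt v] != 0.
  rewrite -rootE /p -(big_map pt xpredT (fun x => 'X - x%:P)) root_prod_XsubC.
  by apply: contraNN vT => /mapP[u uT /pt_inj ->]; rewrite -mem_enum.
have sp : (size ((p.[pt v])^-1 *: p) <= n)%N.
  by rewrite size_scale ?invr_eq0 // size_prod_XsubC -cardE.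
exists (fun i => ((p.[pt v])^-1 *: p)`_i); split=> [|u uT].
  by rewrite hp // hornerZ mulVf.
rewrite hp // hornerZ; apply/eqP; rewrite mulf_eq0 -rootE orbC.
rewrite /p -(big_map pt xpredT (fun x => 'X - x%:P)) root_prod_XsubC.
by rewrite map_f // mem_enum.
Qed.

(** The lift is [wedge f a] with f from [dual_functional]: since [a] is killed by v and by T,
    [contract_wedge] reduces each of these contractions of it to a pairing times [a]. *)
Lemma contract_surj r v T (a : ext K n r) :
  v \notin T -> (#|T| < n)%N -> a \in ann r (v |: T) ->
  exists2 b, b \in ann r.+1 T & contract (moment v) b = a.
Proof.
move=> vT Tn; have [f [fv fT]] := dual_functional vT Tn.
move=> aA; exists (wedge f a).
  apply/annP => u uT; case: r a aA => [|r] a aA.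
    by rewrite contract_wedge0 fT // scale0r.
  have := contract_wedge (moment u) f a.
  rewrite (annP _ _ aA) ?inE ?uT ?orbT // wedge0 addr0 => ->.
  by rewrite fT // scale0r.
case: r a aA => [|r] a aA; first by rewrite contract_wedge0 fv scale1r.
have := contract_wedge (moment v) f a.
rewrite (annP _ _ aA) ?inE ?eqxx // wedge0 addr0 => ->.
by rewrite fv scale1r.
Qed.

(** On [ann r.+1 (U :\ v)] contraction with v has kernel [ann r.+1 U] and image [ann r U], so the
    dimensions obey Pascal's rule. *)
Lemma dim_ann r U : (#|U| <= n)%N -> \dim (ann r U) = 'C(n - #|U|, r).
Proof.
elim: r U => [|r IHr] U Un; first by rewrite dim_ext !bin0.
elim: {U}#|U| {-2}U (erefl #|U|) Un => [|m IHm] U Um Un.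
  move/eqP: Um; rewrite cards_eq0 => /eqP->.
  by rewrite /= big_set0 dim_ext cards0 subn0.
have /card_gt0P[v vU] : (0 < #|U|)%N by rewrite Um.
have cT : #|U :\ v| = m by have := cardsD1 v U; rewrite vU Um => -[].
rewrite Um in Un *.
have vT : v \notin U :\ v by rewrite !inE eqxx.
have /= := limg_ker_dim (linfun (@contract K n (moment v) r)) (ann r.+1 (U :\ v)).
rewrite (IHm _ cT) ?cT ?(ltnW Un) //.
have -> : (linfun (@contract K n (moment v) r) @: ann r.+1 (U :\ v) = ann r U)%VS.
  apply/eqP; rewrite eqEsubv; apply/andP; split; apply/subvP => a.
    by case/memv_imgP => b bA ->; rewrite lfunE /= -(setD1K vU); exact: ann_contract.
  rewrite -{1}(setD1K vU) => /(contract_surj vT); rewrite cT => /(_ Un)[b bA <-].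
  by apply/memv_imgP; exists b => //; rewrite lfunE.
have -> : (ann r.+1 (U :\ v) :&: lker (linfun (@contract K n (moment v) r)) = ann r.+1 U)%VS.
  apply/vspaceP => a; rewrite memv_cap memv_ker lfunE /=.
  apply/andP/idP => [[/annP aT /eqP av]|/annP aU].
    apply/annP => u uU; have [->//|uv] := eqVneq u v.
    by apply: aT; rewrite !inE uv.
  by split; [apply/annP => u /setD1P[_ /aU]|apply/eqP/aU].
rewrite IHr ?Um // -(subnSK Un) binS => /eqP; rewrite eqn_add2r => /eqP.
by rewrite subnS.
Qed.

End Annihilator.

(** * Chains with coefficients in annihilators *)

Lemma order_complexS d (T : finPOrderType d) (A s t : {set T}) :
  s \subset t -> t \in order_complex A -> s \in order_complex A.
Proof.
move=> st; rewrite !inE => /andP[tA /forall_inP h].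
rewrite (subset_trans st tA) /=; apply/forall_inP => x xs; apply/forall_inP => y ys.
by have /forall_inP := h x (subsetP st x xs); apply; exact: (subsetP st).
Qed.

Lemma order_complexT d (T : finPOrderType d) (A s : {set T}) :
  s \in order_complex A -> s \in order_complex [set: T].
Proof. by rewrite !inE subsetT => /andP[_ ->]. Qed.

Section Acyclicity.
Variables (K : fieldType) (n : nat) (V : finType) (pt : V -> K).
Hypothesis pt_inj : injective pt.
Variables (d : Order.disp_t) (T : finPOrderType d) (A : {set T}).
Variable VS : {set T} -> {set V}.
Hypothesis VS_mono : forall s t : {set T}, s \subset t -> VS s \subset VS t.
Hypothesis VS_card : forall s, s \in order_complex A -> (#|VS s| <= n)%N.
Implicit Types (U W : {set V}) (s t : {set T}) (j r : nat).

(** Chains of the open star of W, that is of the order complex modulo the simplices whose vertices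
    do not include W. The differential of this quotient is [bd] read only at those t with W inside
    [VS t], which explains the conditions below. The size j is the dimension plus one. *)
Definition supported (M : nmodType) j W (z : {set T} -> M) :=
  forall s, z s != 0 -> [/\ s \in order_complex A, #|s| = j & W \subset VS s].

Hypothesis acyclic : forall W j (z : {set T} -> K^o), W != set0 -> (j < n)%N ->
  supported j W z ->
  (forall t, t \in order_complex A -> W \subset VS t -> bd z t = 0) ->
  exists2 y : {set T} -> K^o, supported j.+1 W y &
    forall t, t \in order_complex A -> W \subset VS t -> bd y t = z t.

Lemma bd_bd_supported (M : lmodType K) j W (z : {set T} -> M) t :
  supported j W z -> bd (bd z) t = 0.
Proof. by move=> zP; apply: bd_bd => s /zP[/order_complexT]. Qed.

Lemma supportedW (M : nmodType) j U W (z : {set T} -> M) :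
  U \subset W -> supported j W z -> supported j U z.
Proof. by move=> UW zP s /zP[sA sj /(subset_trans UW)]. Qed.

Lemma bd_supported (M : lmodType K) j (z : {set T} -> M) :
  supported j.+1 set0 z -> supported j set0 (bd z).
Proof.
move=> zP s /bd_neq0[x xs /zP[sA]]; rewrite cardsU1 xs => -[sj] _.
by split; rewrite ?sub0set //; apply: order_complexS sA; exact: subsetUr.
Qed.

(** The coefficients are constant, so each coordinate in a basis of N is bounded separately. *)
Lemma acyclic_vspace W j (E : vectType K) (N : {vspace E}) (z : {set T} -> E) :
  W != set0 -> (j < n)%N -> supported j W z -> (forall s, z s \in N) ->
  (forall t, t \in order_complex A -> W \subset VS t -> bd z t = 0) ->
  exists y : {set T} -> E, [/\ supported j.+1 W y, forall s, y s \in N &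
    forall t, t \in order_complex A -> W \subset VS t -> bd y t = z t].
Proof.
move=> W0 jn zP zN dz.
have /choice[y yP] : forall i : 'I_(\dim N), exists y : {set T} -> K^o,
    supported j.+1 W y /\ forall t, t \in order_complex A -> W \subset VS t ->
      bd y t = coord (vbasis N) i (z t).
  move=> i; have [||y y1 y2] := acyclic W0 jn (z := fun s => coord (vbasis N) i (z s) : K^o).
  - by move=> s h; apply: zP; apply: contra_neq h => ->; rewrite linear0.
  - by move=> t tA Wt; rewrite -linear_bd dz // linear0.
  by exists y.
exists (fun s => \sum_i y i s *: (vbasis N)`_i); split=> [s|s|t tA Wt].
- move=> h; apply: contrapT => ns; move/negP: h; apply; apply/eqP.
  apply: big1 => i _; have [-> |/(proj1 (yP i))//] := eqVneq (y i s) 0.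
  by rewrite scale0r.
- by apply: memv_suml => i _; apply/memvZ/vbasis_mem/mem_nth; rewrite size_tuple.
rewrite bd_sum [RHS](coord_vbasis (zN t)); apply: eq_bigr => i _.
rewrite -(proj2 (yP i)) // scaler_suml; apply: eq_bigr => x _.
by rewrite scalerA.
Qed.

(** Only the vertices in U impose a condition: U empty gives the whole exterior power, U full gives
    the G of the overview. The inductions below add the vertices one at a time. *)
Let G r U s := ann n pt r (U :&: VS s).

Lemma annIS r U s t (a : ext K n r) : s \subset t -> a \in G r U t -> a \in G r U s.
Proof. by move=> st; apply: annS; apply/setIS/VS_mono. Qed.

Lemma bd_ann r U (z : {set T} -> ext K n r) t :
  (forall s, z s \in G r U s) -> bd z t \in G r U t.
Proof.
move=> zG; apply: memv_suml => x _; apply: memvZ.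
by apply: annIS (zG _); exact: subsetUr.
Qed.

(* Corrects [y] along the new vertex [v]: if the contraction of [y] by [v]
   bounds in degree [r], lifting the bounding chain back to degree [r.+1] and
   subtracting its boundary kills that contraction. *)
Lemma ann_correct r U v j (y : {set T} -> ext K n r.+1) (u : {set T} -> ext K n r) W :
  v \notin U -> (forall s, y s \in G r.+1 U s) -> (forall s, u s \in G r (v |: U) s) ->
  supported j (v |: W) u ->
  (forall t, t \in order_complex A -> v |: W \subset VS t ->
     bd u t = contract (moment pt v) (y t)) ->
  exists2 u' : {set T} -> ext K n r.+1, supported j (v |: W) u' &
    forall s, s \in order_complex A -> W \subset VS s ->
      y s - bd u' s \in G r.+1 (v |: U) s.
Proof.
move=> vU yG uG uP du.
have /choice[u' u'P] s : exists b, [/\ b \in G r.+1 U s, (u s = 0 -> b = 0) &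
    contract (moment pt v) b = u s].
  have [->|us] := eqVneq (u s) 0; first by exists 0; rewrite mem0v linear0.
  have [sA _ /subUsetP[]] := uP _ us; rewrite sub1set => vs _.
  have [|||b b1 b2] := contract_surj pt_inj (r := r) (v := v) (T := U :&: VS s)
    (a := u s).
  - by rewrite inE (negPf vU).
  - apply: leq_trans (VS_card sA); apply: proper_card.
    by apply/properP; split; [exact: subsetIr|exists v; rewrite // inE (negPf vU)].
  - by have := uG s; rewrite /G setIUl (setIidPl _) // sub1set.
  by exists b; split=> // u0; rewrite u0 eqxx in us.
exists u' => [s h|s sA Ws].
  by apply: uP; apply: contra_neq h => /(let: And3 _ h _ := u'P s in h).
have yU : y s - bd u' s \in G r.+1 U s.
  by apply: memvB => //; apply: bd_ann => t; have [] := u'P t.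
apply/annP => w; rewrite !inE => /andP[/orP[/eqP->|wU] ws]; last first.
  by move/annP: yU; apply; rewrite inE wU.
rewrite linearB /= linear_bd; apply/eqP; rewrite subr_eq0; apply/eqP.
rewrite -du //; last by rewrite subUset sub1set ws.
by apply: eq_bd => x _ /=; have [_ _ ->] := u'P (x |: s).
Qed.

Lemma contract_ann r U v s (a : ext K n r.+1) :
  a \in G r.+1 U s -> contract (moment pt v) a \in G r (v |: U) s.
Proof.
move=> /(ann_contract v); apply: annS; rewrite setIUl.
by apply: setSU; exact: subsetIl.
Qed.

(** If U = W the coefficients are constant, every simplex of the star having all of W among its
    vertices. A further vertex v is imposed by bounding a contraction, in exterior degree one lower,
    on the smaller star of [v |: W]. *)
Lemma ann_acyclic r j U W (z : {set T} -> ext K n r) :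
  W != set0 -> W \subset U -> (j + r < n)%N -> supported j W z ->
  (forall s, z s \in G r U s) ->
  (forall t, t \in order_complex A -> W \subset VS t -> bd z t = 0) ->
  exists y : {set T} -> ext K n r, [/\ supported j.+1 W y,
    forall s, y s \in G r U s &
    forall t, t \in order_complex A -> W \subset VS t -> bd y t = z t].
Proof.
elim: r j U W z => [|r IHr] j U W z W0 WU jr zP zG dz.
  rewrite addn0 in jr.
  have [y [yP _ dy]] := acyclic_vspace W0 jr zP (fun s => memvf (z s)) dz.
  by exists y; split=> // s; exact: memvf.
have jn : (j < n)%N by apply: leq_ltn_trans jr; exact: leq_addr.
elim: {U}#|U :\: W| {-2}U (erefl #|U :\: W|) WU z zP zG dz => [|m IHm] U Um WU z zP zG dz.
  have UW : U = W.
    by apply/eqP; rewrite eqEsubset WU andbT -setD_eq0 -cards_eq0 Um.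
  have zN s : z s \in ann n pt r.+1 W.
    have [->|/zP[_ _ Ws]] := eqVneq (z s) 0; first exact: mem0v.
    by have := zG s; rewrite /G UW (setIidPl Ws).
  have [y [yP yN dy]] := acyclic_vspace W0 jn zP zN dz.
  exists y; split=> // s.
  by rewrite UW; apply: annS (yN s); exact: subsetIl.
have /card_gt0P[v] : (0 < #|U :\: W|)%N by rewrite Um.
rewrite inE => /andP[vW vU].
have WT : W \subset U :\ v by rewrite subsetD1 WU.
have Tm : #|(U :\ v) :\: W| = m.
  have := cardsD1 v (U :\: W); rewrite Um inE vW vU => -[->].
  by apply: eq_card => x; rewrite !inE andbCA.
have vT : v \notin U :\ v by rewrite !inE eqxx.
have zT s : z s \in G r.+1 (U :\ v) s.
  by apply: annS (zG s); apply: setSI; exact: subD1set.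
have [y [yP yG dy]] := IHm _ Tm WT z zP zT dz.
(* A relative cycle on the star of [v |: W]: its boundary there is the contraction by v of [bd y] =
   z, and v kills z. *)
pose u0 s := if v \in VS s then contract (moment pt v) (y s) else 0.
have [||||||u [uP uG du]] := IHr j.+1 U (v |: W) u0.
- by apply/set0Pn; exists v; rewrite !inE eqxx.
- by rewrite subUset sub1set vU.
- by rewrite addSnnS.
- move=> s; rewrite /u0; case: ifP => vs; last by rewrite eqxx.
  move=> h; have [|sA sj Ws] := yP s.
    by apply: contra_neq h => ->; rewrite linear0.
  by split=> //; rewrite subUset sub1set vs.
- move=> s; rewrite /u0; case: ifP => _; last exact: mem0v.
  by rewrite -{1}(setD1K vU); exact: contract_ann.
- move=> t tA; rewrite subUset sub1set => /andP[vt Wt].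
  have -> : bd u0 t = contract (moment pt v) (bd y t).
    rewrite linear_bd; apply: eq_bd => x _ /=.
    by rewrite /u0 (subsetP (VS_mono (subsetUr _ _)) _ vt).
  rewrite dy //; have /annP -> // := zG t.
  by rewrite inE vU.
have [|||u' u'P yu'] := ann_correct (u := u) (j := j.+2) (W := W) vT yG.
- by rewrite setD1K.
- by [].
- move=> t tA Wt; rewrite du // /u0; case: ifP => // /negP[].
  by move: Wt; rewrite subUset sub1set => /andP[].
have dbu' s : bd u' s != 0 -> s \in order_complex A /\ #|s| = j.+1.
  have : supported j.+2 set0 u' by apply: supportedW u'P; exact: sub0set.
  by move/bd_supported/(_ s)/[apply] => -[].
(* [bd u'] is taken in the whole order complex and may leave the star of W. Cutting it off alters no
   boundary at a t with W inside [VS t]. *)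
pose y' s := if (s \in order_complex A) && (W \subset VS s) then y s - bd u' s else 0.
exists y'; split=> [s|s|t tA Wt].
- rewrite /y'; case: ifP => [/andP[sA Ws] h|]; last by rewrite eqxx.
  split=> //; have [ys|/yP[]//] := eqVneq (y s) 0.
  by move: h; rewrite ys sub0r oppr_eq0 => /dbu'[].
- rewrite /y'; case: ifP => [/andP[sA Ws]|_]; last exact: mem0v.
  by have := yu' s sA Ws; rewrite setD1K.
rewrite -(dy t) // -[RHS]subr0 -(bd_bd_supported t u'P) -bdB.
apply: eq_bd => x xt; rewrite /y' (subset_trans Wt (VS_mono (subsetUr _ _))) andbT.
case: ifP => // /negbT xA; apply/eqP; rewrite eq_sym subr_eq0; apply/eqP.
have -> : y (x |: t) = 0 by apply: contraNeq xA => /yP[].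
by apply/esym; apply: contraNeq xA => /dbu'[].
Qed.

(** A cycle modulo G bounds modulo G. When v is added to U, contraction with v turns the defect
    [z - bd y] into a relative cycle on the star of v, one exterior degree lower, where
    [ann_acyclic] applies with W = {v}. *)
Lemma ann_exact r j U (z : {set T} -> ext K n r) :
  (j + r <= n)%N -> supported j set0 z -> (forall s, bd z s \in G r U s) ->
  exists2 y : {set T} -> ext K n r, supported j.+1 set0 y &
    forall s, z s - bd y s \in G r U s.
Proof.
case: r z => [|r] z jr zP dz.
  by exists (fun=> 0) => [s|s]; [rewrite eqxx|exact: memvf].
elim: {U}#|U| {-2}U (erefl #|U|) dz => [|m IHm] U Um dz.
  exists (fun=> 0) => [s|s]; first by rewrite eqxx.
  move/eqP: Um; rewrite cards_eq0 => /eqP->.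
  by apply/annP => u; rewrite set0I inE.
have /card_gt0P[v vU] : (0 < #|U|)%N by rewrite Um.
have cT : #|U :\ v| = m by have := cardsD1 v U; rewrite vU Um => -[].
have vT : v \notin U :\ v by rewrite !inE eqxx.
have dzT s : bd z s \in G r.+1 (U :\ v) s.
  by apply: annS (dz s); apply: setSI; exact: subD1set.
have [y yP zy] := IHm _ cT dzT.
pose u0 s := if v \in VS s then contract (moment pt v) (z s - bd y s) else 0.
have zyP s : z s - bd y s != 0 -> s \in order_complex A /\ #|s| = j.
  have [->|/zP[]//] := eqVneq (z s) 0.
  by rewrite sub0r oppr_eq0 => /(bd_supported yP)[].
have [||||||u [uP uG du]] := @ann_acyclic r j U [set v] u0.
- by apply/set0Pn; exists v; rewrite inE.
- by rewrite sub1set.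
- by rewrite addnS in jr.
- move=> s; rewrite /u0; case: ifP => vs; last by rewrite eqxx.
  move=> h; have [|sA sj] := zyP s.
    by apply: contra_neq h => ->; rewrite linear0.
  by rewrite sub1set.
- move=> s; rewrite /u0; case: ifP => _; last exact: mem0v.
  by rewrite -{1}(setD1K vU); exact: contract_ann.
- move=> t tA; rewrite sub1set => vt.
  have -> : bd u0 t = contract (moment pt v) (bd (fun s => z s - bd y s) t).
    rewrite linear_bd; apply: eq_bd => x _ /=.
    by rewrite /u0 (subsetP (VS_mono (subsetUr _ _)) _ vt).
  rewrite bdB (bd_bd_supported t yP) subr0; have /annP -> // := dz t.
  by rewrite inE vU.
have [|||u' u'P yu'] := ann_correct (u := u) (j := j.+1) (W := set0) vT zy.
- by rewrite setD1K.
- by rewrite setU0.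
- move=> t tA; rewrite setU0 => Wt; rewrite du // /u0; case: ifP => // /negP[].
  by rewrite sub1set in Wt.
have u'P0 : supported j.+1 set0 u' by apply: supportedW u'P; exact: sub0set.
exists (fun s => y s + u' s) => [s h|s].
  have [ys|/yP//] := eqVneq (y s) 0.
  by apply: u'P0; move: h; rewrite ys add0r.
rewrite bdD opprD addrA; have [sA|sA] := boolP (s \in order_complex A).
  by have := yu' s sA (sub0set _); rewrite setD1K.
have -> : z s - bd y s = 0 by apply: contraNeq sA => /zyP[].
have -> : bd u' s = 0 by apply: contraNeq sA => /(bd_supported u'P0)[].
by rewrite subr0 mem0v.
Qed.

End Acyclicity.

(** * Vertices of a simplicial poset *)

Section Vertices.
Variables (d : Order.disp_t) (S : finBPOrderType d) (hS : simplicial_poset S).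
Implicit Types (v w x y z : S).

Definition atom v := (v != \bot%O) && [forall w, (w < v)%O ==> (w == \bot%O)].

Definition verts x : {set S} := [set v | atom v & (v <= x)%O].

Lemma lower_iso x : exists phi : {set 'I_(face_card hS x)} -> S,
  [/\ forall B C, (phi B <= phi C)%O = (B \subset C),
      forall B, (phi B <= x)%O,
      forall y, (y <= x)%O -> exists B, y = phi B &
      forall B, verts (phi B) = [set phi [set i] | i in B]].
Proof.
have /existsP[phi /andP[/forallP mono /forallP onto]] := xchooseP (hS x).
have le_phi B C : (phi B <= phi C)%O = (B \subset C).
  by apply/eqP; have /forallP := mono B; apply.
have phi_le B : (phi B <= x)%O.
  by rewrite (eqP (onto _)); apply/existsP; exists B.
have phi_onto y : (y <= x)%O -> exists B, y = phi B.
  by rewrite (eqP (onto y)) => /existsP[B /eqP <-]; exists B.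
have phi_inj : injective phi.
  by move=> B C e; apply/eqP; rewrite eqEsubset -!le_phi e lexx.
have phi0 : phi set0 = \bot%O.
  have [B e] := phi_onto \bot%O (le0x _).
  by apply/eqP; rewrite -lex0 [X in (_ <= X)%O]e le_phi sub0set.
have atomP B : atom (phi B) = (#|B| == 1%N).
  apply/andP/cards1P => [[B0 /forallP h]|[i ->]].
    have /set0Pn[i iB] : B != set0 by apply: contraNneq B0 => ->; rewrite phi0.
    exists i; have := h (phi [set i]); rewrite lt_neqAle le_phi sub1set iB andbT.
    rewrite -phi0 !(inj_eq phi_inj); have [->//|_ /=] := eqVneq [set i] B.
    by rewrite -cards_eq0 cards1.
  split; first by rewrite -phi0 (inj_eq phi_inj) -cards_eq0 cards1.
  apply/forallP => w; apply/implyP => wi.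
  have [C e] := phi_onto w (le_trans (ltW wi) (phi_le _)).
  move: wi; rewrite e lt_neqAle le_phi (inj_eq phi_inj) subset1 -phi0 (inj_eq phi_inj).
  by case: eqP.
exists phi; split=> // B; apply/setP => v; rewrite inE.
apply/andP/imsetP => [[av vB]|[i iB ->]]; last first.
  by rewrite atomP cards1 le_phi sub1set.
have [C e] := phi_onto v (le_trans vB (phi_le B)).
move: av vB; rewrite e atomP => /cards1P[i ->]; rewrite le_phi sub1set => iB.
by exists i.
Qed.

Lemma vertsS x y : (x <= y)%O -> verts x \subset verts y.
Proof.
move=> xy; apply/subsetP => v; rewrite !inE => /andP[->] /le_trans; exact.
Qed.

Lemma verts_face x B (phi : {set 'I_(face_card hS x)} -> S) :
  (forall B C, (phi B <= phi C)%O = (B \subset C)) ->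
  (forall B, verts (phi B) = [set phi [set i] | i in B]) ->
  #|verts (phi B)| = #|B|.
Proof.
move=> le_phi vB; rewrite vB card_imset // => i j e.
by apply/eqP; rewrite -in_set1 -sub1set -le_phi e le_phi.
Qed.

Lemma card_verts x : #|verts x| = face_card hS x.
Proof.
have [phi [le_phi phi_le phi_onto vphi]] := lower_iso x.
have [B e] := phi_onto x (lexx x).
have ex : x = phi [set: 'I_(face_card hS x)].
  by apply/eqP; rewrite eq_le phi_le {1}e le_phi subsetT.
by rewrite {1}ex (verts_face _ le_phi vphi) cardsT card_ord.
Qed.

(** The common bound z is essential: distinct faces may have the same vertices, but below z the
    poset is a Boolean lattice. *)
Lemma le_verts x y z : (x <= z)%O -> (y <= z)%O ->
  (x <= y)%O = (verts x \subset verts y).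
Proof.
move=> xz yz; apply/idP/idP; first exact: vertsS.
have [phi [le_phi phi_le phi_onto vphi]] := lower_iso z.
have [[B ->] [C ->]] := (phi_onto x xz, phi_onto y yz).
rewrite le_phi !vphi => /subsetP h; apply/subsetP => i iB.
have /imsetP[j jC e] := h (phi [set i]) (imset_f _ iB).
suff -> : i = j by [].
by apply/eqP; rewrite -in_set1 -sub1set -le_phi e le_phi.
Qed.

Lemma verts_inj x y z : (x <= z)%O -> (y <= z)%O -> verts x = verts y -> x = y.
Proof.
by move=> xz yz e; apply/eqP; rewrite eq_le (le_verts xz yz) (le_verts yz xz) e subxx.
Qed.

Lemma verts_remove y v : exists z, (z <= y)%O /\ verts z = verts y :\ v.
Proof.
have [vy|vy] := boolP (v \in verts y); last first.
  exists y; split=> //; apply/setP => w; rewrite !inE.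
  by case: eqP vy => [->|]; rewrite // inE => /negbTE.
have [phi [le_phi phi_le phi_onto vphi]] := lower_iso y.
have [B e] := phi_onto y (lexx y).
move: vy; rewrite {1}e vphi => /imsetP[i iB vi].
exists (phi (B :\ i)); split=> //.
rewrite [in RHS]e !vphi vi; apply/setP => w; rewrite !inE.
have phi1 (a b : 'I_(face_card hS y)) : (phi [set a] == phi [set b]) = (a == b).
  apply/eqP/eqP => [e'|->//]; apply/eqP; rewrite -in_set1 -sub1set -le_phi e' le_phi; exact: subxx.
apply/imsetP/andP => [[j]|[wi /imsetP[j jB wj]]].
  by rewrite !inE => /andP[ji jB] ->; rewrite phi1 ji imset_f.
by exists j => //; rewrite !inE jB andbT -phi1 -wj.
Qed.

Lemma verts0 : verts \bot%O = set0.
Proof. by apply/setP => v; rewrite !inE lex0 /atom; case: eqP; rewrite ?andbF. Qed.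

Lemma verts_eq0 x : (verts x == set0) = (x == \bot%O).
Proof.
apply/eqP/eqP => [x0|->]; last exact: verts0.
by apply: (@verts_inj _ _ x); rewrite ?verts0 ?le0x.
Qed.

Lemma mobius x : x != \bot%O ->
  \sum_(y | (y <= x)%O) (-1) ^+ #|verts y| = 0 :> int.
Proof.
move=> x0; have [phi [le_phi phi_le phi_onto vphi]] := lower_iso x.
have m0 : (0 < face_card hS x)%N by rewrite -card_verts lt0n cards_eq0 verts_eq0.
have phi_inj : injective phi.
  by move=> B C e; apply/eqP; rewrite eqEsubset -!le_phi e lexx.
rewrite (reindex phi) /=; last first.
  exists (fun y => odflt set0 [pick B | phi B == y]) => [B _|y /phi_onto[B ->]].
    by case: pickP => [C /eqP/phi_inj //|/(_ B)]; rewrite eqxx.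
  by case: pickP => [C /eqP//|/(_ B)]; rewrite eqxx.
under eq_big do [rewrite phi_le|rewrite (verts_face _ le_phi vphi)].
(* Through [phi] the sum runs over the subsets of a nonempty set and expands a power of -1 + 1. *)
transitivity (\prod_(i < face_card hS x) (-1 + 1 : int)); last first.
  by rewrite addNr prodr_const card_ord expr0n eqn0Ngt m0.
rewrite bigA_distr; apply: eq_bigr => B _.
by rewrite -big_mkcond prodr_const.
Qed.

End Vertices.

(** * Acyclicity of open stars *)

Lemma order_complexU1 d (T : finPOrderType d) (A s : {set T}) x :
  (x |: s \in order_complex A) =
  [&& s \in order_complex A, x \in A & [forall y in s, (x <= y)%O || (y <= x)%O]].
Proof.
apply/idP/and3P => [h|[]].
  split; first by apply: order_complexS h; exact: subsetUr.
    by move: h; rewrite inE subUset sub1set => /andP[/andP[]].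
  move: h; rewrite inE => /andP[_ /forall_inP/(_ x (setU11 _ _))/forall_inP h].
  by apply/forall_inP => y ys; apply: h; rewrite inE ys orbT.
rewrite !inE => /andP[sA /forall_inP h] xA /forall_inP hx.
rewrite subUset sub1set xA sA /=; apply/forall_inP => y.
rewrite !inE => /orP[/eqP->|ys]; apply/forall_inP => w.
  by rewrite !inE => /orP[/eqP->|/hx//]; rewrite lexx.
rewrite !inE => /orP[/eqP->|ws]; first by rewrite orbC hx.
by have /forall_inP := h y ys; apply.
Qed.

Section StarAcyclic.
Variables (K : fieldType) (d : Order.disp_t) (S : finBPOrderType d).
Hypothesis hS : simplicial_poset S.
Implicit Types (a v w x y : S) (W s t : {set S}) (j : nat).

Definition up a : {set S} := [set x | (a < x)%O].

(** For a chain of faces this is the vertex set of the largest one ([vset_top]), but the union is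
    monotone on arbitrary sets, as [VS_mono] requires. *)
Definition vset s : {set S} := \bigcup_(x in s) verts x.

Lemma vsetS s t : s \subset t -> vset s \subset vset t.
Proof.
move=> st; apply/bigcupsP => x xs; apply: bigcup_sup; exact: (subsetP st).
Qed.

Lemma vsetU1 x s : vset (x |: s) = verts x :|: vset s.
Proof.
apply/setP => v; apply/bigcupP/setUP => [[y]|].
  rewrite in_setU1 => /orP[/eqP->|ys] vy; [by left|right].
  by apply/bigcupP; exists y.
case=> [vx|/bigcupP[y ys vy]]; first by exists x; rewrite ?setU11.
by exists y; rewrite // in_setU1 ys orbT.
Qed.

Lemma verts_lt x y : (x < y)%O -> verts x \proper verts y.
Proof.
move=> xy; rewrite properEneq vertsS ?ltW // andbT.
by apply/eqP => e; move: (xy); rewrite (verts_inj hS (ltW xy) (lexx y) e) ltxx.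
Qed.

(** * The matching that inserts or deletes the face opposite to v *)

Section Toggle.
Variables (a v : S) (W : {set S}).
Hypotheses (va : v \notin verts a) (vW : v \in W).

Definition star s := (s \in order_complex (up a)) && (W \subset verts a :|: vset s).

Definition lowest s x :=
  [&& x \in s, v \in verts x & [forall w in s, (v \in verts w) ==> (x <= w)%O]].

(** The default is not reached on the star: v lies in W and not in [verts a], so some member of s
    contains it. *)
Definition low s := odflt a [pick x | lowest s x].

Definition removed y := odflt a [pick x | (x <= y)%O && (verts x == verts y :\ v)].

(** The members of s not above [low s] avoid v, hence lie under the face of [low s] opposite to v.
    That face can thus be inserted into the chain; deleting it loses no vertex, as [low s] lies
    above it. Since it avoids v, [low] and [partner] stay the same. *)
Definition partner s := removed (low s).

Lemma removedP y : (removed y <= y)%O /\ verts (removed y) = verts y :\ v.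
Proof.
rewrite /removed; case: pickP => [x /andP[xy /eqP]//|/= h].
have [z [zy vz]] := verts_remove hS y v.
by have := h z; rewrite zy vz eqxx.
Qed.

Lemma low_eq s x : lowest s x -> low s = x.
Proof.
move=> xP; rewrite /low; case: pickP => [y yP|/(_ x)/=]; last by rewrite xP.
move: xP yP => /and3P[xs vx /forall_inP hx] /and3P[ys vy /forall_inP hy] /=.
by apply/eqP; rewrite eq_le (implyP (hx _ ys)) // (implyP (hy _ xs)).
Qed.

Lemma star_chain s x y : star s -> x \in s -> y \in s -> (x <= y)%O || (y <= x)%O.
Proof.
case/andP; rewrite inE => /andP[_ /forall_inP h] _ xs ys.
by have /forall_inP := h x xs; apply.
Qed.

Lemma star_up s x : star s -> x \in s -> (a < x)%O.
Proof.
by case/andP; rewrite inE => /andP[/subsetP h _] _ /h; rewrite inE.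
Qed.

Lemma lowP s : star s -> lowest s (low s).
Proof.
move=> sD; have /andP[_ /subsetP/(_ v vW)] := sD.
rewrite inE (negPf va) /= => /bigcupP[x0 x0s vx0].
have P0 : (x0 \in s) && (v \in verts x0) by rewrite x0s.
have [x /andP[xs vx] xmin] := arg_minnP (i0 := x0) (P := fun x => (x \in s) && (v \in verts x))
  (fun x => #|verts x|) P0.
suff xP : lowest s x by rewrite (low_eq xP).
apply/and3P; split=> //; apply/forall_inP => w ws; apply/implyP => vw.
have /orP[//|wx] := star_chain sD xs ws.
move: (wx); rewrite le_eqVlt => /orP[/eqP->//|/verts_lt/proper_card].
by rewrite ltnNge xmin // ws.
Qed.

Lemma low_in s : star s -> low s \in s. Proof. by case/lowP/and3P. Qed.
Lemma v_low s : star s -> v \in verts (low s). Proof. by case/lowP/and3P. Qed.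
Lemma low_le s w : star s -> w \in s -> v \in verts w -> (low s <= w)%O.
Proof. by case/lowP/and3P => _ _ /forall_inP h /h /implyP. Qed.

Lemma starU1 s x : star s -> x |: s \in order_complex (up a) -> star (x |: s).
Proof.
move=> /andP[_ Ws] xs; rewrite /star xs (subset_trans Ws) // setUS // vsetS //.
exact: subsetUr.
Qed.

Lemma lowU1 s x : star s -> star (x |: s) ->
  low (x |: s) = low s \/ (#|verts (low (x |: s))| < #|verts (low s)|)%N.
Proof.
move=> sD xsD; have : (low (x |: s) <= low s)%O.
  by apply: low_le; rewrite // ?v_low // inE low_in ?orbT.
by rewrite le_eqVlt => /orP[/eqP|/verts_lt/proper_card]; [left|right].
Qed.

Lemma pv_ge s : star s -> (a <= partner s)%O.
Proof.
move=> sD; have [pl vp] := removedP (low s).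
have al := ltW (star_up sD (low_in sD)).
rewrite (le_verts hS al pl) vp subsetD1 va andbT.
exact: vertsS.
Qed.

Lemma v_pv s : v \notin verts (partner s).
Proof. by have [_ ->] := removedP (low s); rewrite !inE eqxx. Qed.

Lemma le_pv s w : star s -> w \in s -> ~~ (low s <= w)%O -> (w <= partner s)%O.
Proof.
move=> sD ws lw; have [pl vp] := removedP (low s).
have wl : (w <= low s)%O.
  by have := star_chain sD ws (low_in sD); rewrite (negPf lw) orbF.
rewrite (le_verts hS wl pl) vp subsetD1 vertsS //=.
by apply: contra lw; exact: low_le.
Qed.

Lemma star_toggle s : star s -> (a < partner s)%O -> star (partner s |: s).
Proof.
move=> sD ap; apply: starU1 => //; have /andP[sA _] := sD.
rewrite order_complexU1 sA inE ap /=; apply/forall_inP => w ws.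
have [lw|/(le_pv sD ws)->] := boolP (low s <= w)%O; last by rewrite orbT.
by rewrite (le_trans _ lw) //; case: (removedP (low s)).
Qed.

Lemma star_untoggle s : star s -> star (s :\ partner s) /\ low (s :\ partner s) = low s.
Proof.
move=> sD; have /andP[sA Ws] := sD.
have ls : low s \in s :\ partner s.
  rewrite !inE low_in // andbT; apply: contraNneq (v_pv s) => <-.
  exact: v_low.
split; last first.
  apply: low_eq; rewrite /lowest ls v_low //=; apply/forall_inP => w.
  by rewrite inE => /andP[_ ws]; apply/implyP; exact: low_le.
rewrite /star (order_complexS _ sA) ?subD1set //=.
apply: (subset_trans Ws); apply: setUS; apply/bigcupsP => x xs.
have [->|xp] := eqVneq x (partner s); last by apply: bigcup_sup; rewrite !inE xp.
apply: subset_trans (bigcup_sup _ ls); apply: vertsS.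
by case: (removedP (low s)).
Qed.

(** Describes the unmatched simplices: they begin with a face obtained from [a] by adding v, and [a]
    itself may not be inserted. *)
Lemma star_low_lt s : star s -> ~~ (a < partner s)%O ->
  [/\ partner s = a, verts (low s) = v |: verts a &
      forall w, w \in s -> (low s <= w)%O].
Proof.
move=> sD ap; have pa : partner s = a.
  by apply/eqP; move: (pv_ge sD); rewrite le_eqVlt (negPf ap) orbF eq_sym.
split=> // [|w ws].
  by rewrite -pa; have [_ ->] := removedP (low s); rewrite setD1K ?v_low.
apply: contrapT => /negP/(le_pv sD ws); rewrite pa => wa.
by have := star_up sD ws; rewrite lt_leAnge wa andbF.
Qed.

Lemma pv_mono s t : star s -> star t -> (low s <= low t)%O -> (partner s <= partner t)%O.
Proof.
move=> sD tD st; have [[ps vs] [pt vt]] := (removedP (low s), removedP (low t)).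
rewrite (le_verts hS (le_trans ps st) pt) vs vt.
by apply: setSD; exact: vertsS.
Qed.

Lemma bd_bd_star j (z : {set S} -> K^o) t :
  (forall s, z s != 0 -> star s /\ #|s| = j) -> bd (bd z) t = 0.
Proof.
by move=> zP; apply: bd_bd => s /zP[/andP[/order_complexT]].
Qed.

Lemma bd_star j (z : {set S} -> K^o) (t : {set S}) :
  (forall s, z s != 0 -> star s /\ #|s| = j.+1) ->
  bd z t != 0 -> #|t| = j /\ t \in order_complex (up a).
Proof.
move=> zP /bd_neq0[x xt /zP[/andP[xtA _]]]; rewrite cardsU1 xt add1n => -[tj].
by split=> //; apply: order_complexS xtA; exact: subsetUr.
Qed.

Lemma bd_correct j (z y : {set S} -> K^o) t :
  (forall s, z s != 0 -> star s /\ #|s| = j) ->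
  (forall s, y s != 0 -> star s /\ #|s| = j.+1) ->
  (forall s, star s -> bd z s = 0) -> star t ->
  bd (fun s => if star s then z s - bd y s else 0) t = 0.
Proof.
move=> zP yP dz tD; transitivity (bd (fun s => z s - bd y s) t); last first.
  by rewrite bdB dz // (bd_bd_star t yP) subr0.
apply: eq_bd => x xt /=; case: ifP => // xtD.
have -> : z (x |: t) = 0 by apply: contraFeq xtD => /zP[].
suff -> : bd y (x |: t) = 0 by rewrite subr0.
by apply: contraFeq xtD => /(bd_star yP)[_]; exact: starU1.
Qed.

(* Discrete Morse theory: on the chains whose [partner] exceeds [a], adding or
   removing [partner] is a perfect matching; it is acyclic since adding elements
   can only lower [low]. *)
Lemma toggle_acyclic j (z : {set S} -> K^o) :
  (forall s, z s != 0 -> [/\ star s, #|s| = j & (a < partner s)%O]) ->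
  (forall t, star t -> bd z t = 0) ->
  exists2 y : {set S} -> K^o, (forall s, y s != 0 -> star s /\ #|s| = j.+1) &
    forall t, star t -> bd y t = z t.
Proof.
(* On the support of z, [rk s + m] exceeds [#|S|], an upper bound for all ranks. Each step clears
   the lowest rank still allowed; at m = 0 none is left. *)
pose rk s := #|verts (low s)|.
suff main m : forall z : {set S} -> K^o,
    (forall s, z s != 0 -> [/\ star s, #|s| = j & (a < partner s)%O]) ->
    (forall s, z s != 0 -> (#|S| < rk s + m)%N) ->
    (forall t, star t -> bd z t = 0) ->
    exists2 y : {set S} -> K^o, (forall s, y s != 0 -> star s /\ #|s| = j.+1) &
      forall t, star t -> bd y t = z t.
  by move=> zP; apply: (main #|S|.+1) => // s _; rewrite addnS ltnS leq_addl.
elim: m => {z} [|m IHm] z zP zr dz.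
  exists (fun=> 0) => [s|t _]; first by rewrite eqxx.
  rewrite bd_eq0 //; apply/esym/eqP/contraT => /zr.
  by rewrite addn0 ltnNge max_card.
pose B s := [&& star s, (rk s + m)%N == #|S|, (a < partner s)%O & partner s \in s].
(* The sign gives [z (s :\ partner s)] coefficient 1 in the boundary, so [z - bd y] vanishes on the
   simplices of lowest rank that lack their partner. *)
pose y s := if B s then (-1) ^+ position (s :\ partner s) (partner s) *: z (s :\ partner s) else 0.
have yB s : y s != 0 -> B s by rewrite /y; case: ifP; rewrite ?eqxx.
have yP s : y s != 0 -> star s /\ #|s| = j.+1.
  move=> ys; have b := yB s ys; have /and4P[sD _ _ ps] := b; split=> //.
  move: ys; rewrite /y b => ys; have [|_ sj _] := zP (s :\ partner s).
    by apply: contra_neq ys => ->; rewrite scaler0.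
  by have := cardsD1 (partner s) s; rewrite sj ps.
have yU t x : star t -> y (x |: t) != 0 ->
    (rk t + m)%N = #|S| /\ low (x |: t) = low t \/ (#|S| < rk t + m)%N.
  move=> tD /yB/and4P[xtD /eqP rkx _ _]; rewrite -rkx /rk.
  case: (lowU1 tD xtD) => [->|lt]; first by left.
  by right; rewrite ltn_add2r.
pose z2 t : K^o := if star t then z t - bd y t else 0.
have z2D t : z2 t != 0 -> star t by rewrite /z2; case: ifP; rewrite ?eqxx.
have dz2 t : star t -> bd z2 t = 0.
  by apply: bd_correct yP dz => s /zP[].
have z2P t : z2 t != 0 -> [/\ star t, #|t| = j & (a < partner t)%O].
  move=> z2t; have tD := z2D t z2t; move: z2t; rewrite /z2 tD.
  have [->|/zP[]//] := eqVneq (z t) 0.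
  rewrite sub0r oppr_eq0 => dy; have [tj _] := bd_star yP dy; split=> //.
  have [x xt /yB/and4P[xtD _ ap _]] := bd_neq0 dy.
  apply: lt_le_trans ap _; apply: pv_mono => //.
  by case: (lowU1 tD xtD) => [->//|_]; apply: low_le; rewrite ?v_low // inE low_in ?orbT.
have z2lt t : (rk t + m < #|S|)%N -> z2 t = 0.
  move=> rt; rewrite /z2; case: ifP => // tD.
  have -> : z t = 0.
    by apply: contraTeq rt => /zr; rewrite addnS ltnS -leqNgt.
  rewrite bd_eq0 ?subr0 // => x xt; apply/eqP/contraT => /(yU _ _ tD).
  by case=> [[e _]|/(ltn_trans rt)]; [move: rt; rewrite e|]; rewrite ltnn.
have z2pv t : star t -> (rk t + m)%N = #|S| -> partner t \notin t -> z2 t = 0.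
  move=> tD rt pt; rewrite /z2 tD.
  have yx x : x \notin t -> x != partner t -> y (x |: t) = 0.
    move=> xt xp; apply/eqP/contraT => yx.
    have [[_ e]|] := yU _ _ tD yx; last by rewrite rt ltnn.
    have /and4P[_ _ _] := yB _ yx.
    by rewrite /partner e -/(partner t) inE (negPf pt) orbF inE eq_sym (negPf xp).
  rewrite /bd (bigD1 (partner t)) //= big1 ?addr0; last first.
    by move=> x /andP[xt xp]; rewrite yx // scaler0.
  have [ap|ap] := boolP (a < partner t)%O; last first.
    have -> : z t = 0 by apply: contraNeq ap => /zP[].
    suff -> : y (partner t |: t) = 0 by rewrite scaler0 subr0.
    apply/eqP/contraT => yp; have [[_ e]|] := yU _ _ tD yp; last by rewrite rt ltnn.
    by have /and4P[_ _] := yB _ yp; rewrite /partner e -/(partner t) (negPf ap).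
  have e : low (partner t |: t) = low t.
    apply: low_eq; rewrite /lowest inE low_in ?orbT // v_low //=.
    apply/forall_inP => w; rewrite inE => /orP[|wt]; last first.
      by apply/implyP; exact: low_le.
    by rewrite inE => /eqP->; rewrite (negPf (v_pv t)).
  have pe : partner (partner t |: t) = partner t by rewrite /partner e.
  rewrite /y /B star_toggle // /rk e pe rt eqxx ap setU11 /= setU1K //.
  by rewrite scalerA -expr2 sqrr_sign scale1r subrr.
have [|y2 y2P dy2] := IHm z2 z2P _ dz2.
  move=> t z2t; rewrite ltnNge leq_eqVlt; apply/negP => /orP[/eqP rt|/z2lt e]; last first.
    by rewrite e eqxx in z2t.
  have tD := z2D t z2t.
  have [pt|/(z2pv t tD rt) e] := boolP (partner t \in t); last by rewrite e eqxx in z2t.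
  have [uD ue] := star_untoggle tD.
  have up : partner (t :\ partner t) = partner t by rewrite /partner ue.
  have pu : partner t \notin t :\ partner t by rewrite !inE eqxx.
  (* For a simplex of lowest rank containing its partner, the cycle condition at [t :\ partner t]
     retains the single term [z2 t]: the others have smaller rank or lack their partner. *)
  have := dz2 _ uD; rewrite /bd (bigD1 (partner t)) //= big1 ?addr0; last first.
    move=> x /andP[xu xp]; suff -> : z2 (x |: (t :\ partner t)) = 0 by rewrite scaler0.
    apply/eqP/contraT => z2x; have xD := z2D _ z2x.
    case: (lowU1 uD xD) => [e|lt].
      have pe : partner (x |: t :\ partner t) = partner t by rewrite /partner e.
      rewrite z2pv ?eqxx // in z2x; first by rewrite /rk e ue.
      by rewrite pe inE (negPf pu) orbF inE eq_sym.
    rewrite z2lt ?eqxx // in z2x.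
    by rewrite -rt /rk ltn_add2r -ue.
  rewrite setD1K // => /eqP; rewrite scaler_eq0 signr_eq0 /= => e.
  by rewrite e in z2t.
exists (fun s => y s + y2 s) => [s h|t tD].
  have [ys|/yP//] := eqVneq (y s) 0.
  by apply: y2P; move: h; rewrite ys add0r.
by rewrite bdD dy2 // /z2 tD addrC subrK.
Qed.

End Toggle.

Variable n : nat.
(** The Buchsbaum condition in terms of sizes: dimension j - 1 is below n - 1 - |a|, the one degree
    where the link may have homology. *)
Hypothesis link_acyclic : forall a j (z : {set S} -> K^o),
  a != \bot%O -> (j + #|verts a| < n)%N ->
  (forall s, z s != 0 -> s \in order_complex (up a) /\ #|s| = j) ->
  (forall t, t \in order_complex (up a) -> bd z t = 0) ->
  exists2 y : {set S} -> K^o,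
    (forall s, y s != 0 -> s \in order_complex (up a) /\ #|s| = j.+1) &
    forall t, t \in order_complex (up a) -> bd y t = z t.

Lemma order_complex_up a b s : s \in order_complex (up a) -> (a < b)%O ->
  (forall w, w \in s -> (b < w)%O) -> s \in order_complex (up b).
Proof.
rewrite !inE => /andP[_ ->] ab bs; rewrite andbT.
by apply/subsetP => w /bs; rewrite inE.
Qed.

Lemma order_complex_down a b s : s \in order_complex (up b) -> (a < b)%O ->
  b |: s \in order_complex (up a).
Proof.
move=> sb ab; rewrite order_complexU1 [b \in _]inE ab /=.
move: sb; rewrite !inE => /andP[/subsetP sb ->]; rewrite andbT.
apply/andP; split; first by apply/subsetP => w /sb; rewrite !inE; exact: lt_trans.
by apply/forall_inP => w /sb; rewrite inE => /ltW->.
Qed.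

Lemma position_up b s x : (b < x)%O -> b \notin s ->
  position (b |: s) x = (position s x).+1.
Proof.
move=> bx bs; rewrite /position (cardsD1 b) !inE eqxx bx add1n; congr _.+1.
apply: eq_card => w; rewrite !inE.
by case: eqP => [->|_] //=; rewrite (negPf bs).
Qed.

Lemma notin_up b s : s \in order_complex (up b) -> b \notin s.
Proof.
by rewrite inE => /andP[/subsetP h _]; apply/negP => /h; rewrite inE ltxx.
Qed.

(** b has one vertex more than [a], which leaves no room strictly between them. *)
Lemma chain_above_cover a b v s w : v \notin verts a -> verts b = v |: verts a ->
  s \in order_complex (up a) -> b \in s -> w \in s -> w != b -> (b < w)%O.
Proof.
move=> va vb; rewrite inE => /andP[/subsetP sa /forall_inP h] bs ws wb.
have /forall_inP/(_ w ws) := h b bs; rewrite !le_eqVlt eq_sym (negPf wb) /=.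
case/orP=> // wltb; have := sa w ws; rewrite inE => aw.
have := proper_card (verts_lt aw); have := proper_card (verts_lt wltb).
by rewrite vb cardsU1 va add1n ltnS => h1 /leq_trans/(_ h1); rewrite ltnn.
Qed.

(** Induction on the number of vertices of W missing from [a]; when none is missing, the star is the
    whole link. Otherwise let v be one of them: a simplex left unmatched by the toggle begins with a
    cover b of [a] by v, and removing b gives a simplex of the star of W over b, of size one less.
    There may be several b, but no chain contains two of them. *)
Lemma star_acyclic a W j (z : {set S} -> K^o) :
  verts a \subset W -> W != set0 -> (j + #|verts a| < n)%N ->
  (forall s, z s != 0 -> star a W s /\ #|s| = j) ->
  (forall t, star a W t -> bd z t = 0) ->
  exists2 y : {set S} -> K^o, (forall s, y s != 0 -> star a W s /\ #|s| = j.+1) &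
    forall t, star a W t -> bd y t = z t.
Proof.
move=> + W0; elim: {a}#|W :\: verts a| {-2}a (erefl #|W :\: verts a|) j z =>
    [|m IHm] a Wm j z aW jn zP dz.
  have Wa : W = verts a.
    by apply/eqP; rewrite eqEsubset aW andbT -setD_eq0 -cards_eq0 Wm.
  have starE s : star a W s = (s \in order_complex (up a)).
    by rewrite /star Wa subsetUl andbT.
  have a0 : a != \bot%O by rewrite -(verts_eq0 hS) -Wa.
  have [|t|y yP dy] := link_acyclic a0 jn (z := z).
  - by move=> s /zP[]; rewrite starE.
  - by rewrite -starE; exact: dz.
  by exists y => s; rewrite starE; [exact: yP|exact: dy].
have /card_gt0P[v] : (0 < #|W :\: verts a|)%N by rewrite Wm.
rewrite inE => /andP[va vW].
case: j => [|j] in jn zP *.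
  (* The empty simplex is not in the star, lacking v, so z is zero on the star. *)
  exists (fun=> 0) => [s|t tD]; first by rewrite eqxx.
  rewrite bd_eq0 //; apply/esym/eqP/contraT => /zP[/andP[_ /subsetP/(_ v vW) vt] /eqP].
  rewrite cards_eq0 => /eqP t0; move: vt.
  by rewrite t0 /vset big_set0 setU0 (negPf va).
pose cov b := (a < b)%O && (verts b == v |: verts a).
pose zb b s : K^o := if s \in order_complex (up b) then z (b |: s) else 0.
have starb b s : cov b -> star b W s = (s \in order_complex (up b)) && star a W (b |: s).
  case/andP=> ab /eqP vb; rewrite /star; case: (boolP (s \in _)) => //= sb.
  rewrite (order_complex_down sb ab) /= vsetU1 setUA.
  by rewrite (setUidPr (vertsS (ltW ab))).
have /choice[yb ybP] : forall b, exists y : {set S} -> K^o, cov b ->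
    (forall s, y s != 0 -> star b W s /\ #|s| = j.+1) /\
    forall t, star b W t -> bd y t = zb b t.
  move=> b; have [bc|] := boolP (cov b); last by exists z.
  have /andP[ab /eqP vb] := bc.
  have [|||||y yP dy] := IHm b _ j (zb b).
  - have := cardsD1 v (W :\: verts a); rewrite Wm in_setD va vW => -[->].
    by rewrite vb setUC -setDDl.
  - by rewrite vb subUset sub1set vW.
  - by rewrite vb cardsU1 va add1n addnS -addSn.
  - move=> s; rewrite /zb; case: ifP => sb; last by rewrite eqxx.
    move=> /zP[bsD]; rewrite cardsU1 notin_up // => -[sj].
    by rewrite starb // sb.
  - move=> t; rewrite starb // => /andP[tb btD].
    have bt := notin_up tb.
    apply/eqP; rewrite -oppr_eq0 -(dz _ btD) -bdN; apply/eqP.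
    rewrite /bd (bigD1 b) //= {1}/zb (negPf (contraL (@notin_up _ _) _)) ?setU11 //.
    rewrite oppr0 scaler0 add0r; apply: eq_big => [x|x /andP[xt xb]].
      by rewrite !inE negb_or andbC.
    have [z0|/zP[/andP[xbtA _] _]] := eqVneq (z (x |: (b |: t))) 0.
      by rewrite z0 /zb setUCA z0 if_same oppr0 !scaler0.
    have bx : (b < x)%O.
      by apply: (chain_above_cover va vb xbtA); rewrite ?inE ?eqxx ?orbT.
    rewrite position_up // exprS mulN1r scaleNr scalerN setUCA /zb.
    rewrite (order_complex_up _ ab) //; first by apply: order_complexS xbtA; exact/setUS/subsetUr.
    move=> w wxt; apply: (chain_above_cover va vb xbtA); rewrite ?inE ?eqxx ?orbT //.
      by move: wxt; rewrite !inE => /orP[]->; rewrite ?orbT.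
    by apply: contraTneq wxt => ->; rewrite !inE negb_or bt andbT eq_sym.
  by exists y.
(* Inserting b at the bottom shifts all positions by one and so reverses the sign of the boundary;
   the minus compensates. *)
pose y s : K^o :=
  if star a W s && (partner a v s == a) then - yb (low a v s) (s :\ low a v s) else 0.
have lowcov s : star a W s -> partner a v s = a -> cov (low a v s) /\
    s :\ low a v s \in order_complex (up (low a v s)).
  move=> sD ps; have as_ := star_up sD (low_in va vW sD).
  have [|_ vl lw] := star_low_lt va vW sD; first by rewrite ps ltxx.
  split; first by rewrite /cov as_ vl eqxx.
  have /andP[sA _] := sD.
  apply: (order_complex_up (order_complexS (subD1set _ _) sA) as_) => w.
  by rewrite in_setD1 lt_neqAle eq_sym => /andP[-> /lw].
have yP s : y s != 0 -> star a W s /\ #|s| = j.+2.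
  rewrite /y; case: ifP => [/andP[sD /eqP ps]|]; last by rewrite eqxx.
  rewrite oppr_eq0; have [bc _] := lowcov s sD ps => /(proj1 (ybP _ bc))[_].
  by rewrite (cardsD1 (low a v s) s) (low_in va vW sD) => ->.
pose z2 t : K^o := if star a W t then z t - bd y t else 0.
have z2pv t : star a W t -> partner a v t = a -> z2 t = 0.
  move=> tD pt; have [bc tb] := lowcov t tD pt.
  have /andP[ab /eqP vb] := bc; have bt := low_in va vW tD.
  set b := low a v t in bc tb ab vb bt.
  have low_xt x : star a W (x |: t) -> low a v (x |: t) = b.
    move=> xtD; case: (lowU1 va vW tD xtD) => [//|]; rewrite -/b.
    have := proper_card (verts_lt (star_up xtD (low_in va vW xtD))).
    have -> : #|verts b| = #|verts a|.+1 by rewrite vb cardsU1 va.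
    by rewrite ltnS => h /(leq_trans h); rewrite ltnn.
  have y_xt x : x \notin t -> y (x |: t) = - yb b (x |: (t :\ b)).
    move=> xt; have xb : x != b by apply: contraNneq xt => ->.
    have e : x |: (t :\ b) = (x |: t) :\ b.
      by rewrite setDUl; congr (_ :|: _); apply/esym/setDidPl; rewrite disjoints1 inE.
    have be : b |: (x |: (t :\ b)) = x |: t.
      by rewrite e setD1K // in_setU1 bt orbT.
    rewrite /y; case: ifP => [/andP[xtD _]|/negbT nD]; first by rewrite low_xt ?e.
    apply/esym/eqP; rewrite oppr_eq0; apply: contraNT nD.
    move=> /(proj1 (ybP _ bc))[]; rewrite starb // be => /andP[_ xtD] _.
    by rewrite xtD /partner low_xt //=; apply/eqP.
  rewrite /z2 tD; apply/eqP; rewrite subr_eq0; apply/eqP.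
  have tbD : star b W (t :\ b) by rewrite starb // tb setD1K.
  transitivity (bd (yb b) (t :\ b)).
    by rewrite (proj2 (ybP _ bc)) // /zb tb setD1K.
  rewrite /bd (bigD1 b) /=; last by rewrite !inE eqxx.
  rewrite [yb b _](_ : _ = 0) ?scaler0 ?add0r; last first.
    apply/eqP/contraT => /(proj1 (ybP _ bc))[/andP[/notin_up]].
    by rewrite setU11.
  apply: eq_big => [x|x /andP[xtb xb]].
    rewrite in_setD1 negb_and negbK; have [->|xb] := eqVneq x b; first by rewrite bt.
    by rewrite andbT.
  have xt : x \notin t by move: xtb; rewrite in_setD1 xb.
  rewrite y_xt //; have [->|/(proj1 (ybP _ bc))[xtD _]] := eqVneq (yb b (x |: t :\ b)) 0.
    by rewrite oppr0 !scaler0.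
  have bx : (b < x)%O by apply: star_up xtD _; exact: setU11.
  rewrite -[in RHS](setD1K bt) position_up ?setD11 //.
  by rewrite exprS mulN1r scaleNr scalerN opprK setD1K.
have z2P t : z2 t != 0 -> [/\ star a W t, #|t| = j.+1 & (a < partner a v t)%O].
  move=> z2t; have tD : star a W t by move: z2t; rewrite /z2; case: ifP; rewrite ?eqxx.
  split=> //.
    move: z2t; rewrite /z2 tD; have [->|/zP[]//] := eqVneq (z t) 0.
    by rewrite sub0r oppr_eq0 => /(bd_star yP)[].
  rewrite lt_neqAle (pv_ge va vW tD) andbT; apply: contraNneq z2t => e.
  by apply/eqP/z2pv.
have dz2 : forall t, star a W t -> bd z2 t = 0.
  by move=> t; exact: bd_correct zP yP dz.
have [y2 y2P dy2] := toggle_acyclic va vW z2P dz2.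
exists (fun s => y s + y2 s) => [s h|t tD].
  have [ys|/yP//] := eqVneq (y s) 0.
  by apply: y2P; move: h; rewrite ys add0r.
by rewrite bdD dy2 // /z2 tD addrC subrK.
Qed.

End StarAcyclic.

(** * Spaces of chains *)

Section ProductSpace.
Variables (K : fieldType) (I : finType) (E : vectType K) (F : I -> {vspace E}).

Definition eval_at (i : I) (f : {ffun I -> E}) : E := f i.
Lemma eval_at_is_linear i : linear (eval_at i).
Proof. by move=> a f g; rewrite /eval_at !ffunE. Qed.
HB.instance Definition _ i :=
  GRing.isLinear.Build K {ffun I -> E} E _ (eval_at i) (eval_at_is_linear i).

Definition single (i : I) (x : E) : {ffun I -> E} :=
  [ffun j => if j == i then x else 0].
Lemma single_is_linear i : linear (single i).
Proof.
move=> a x y; apply/ffunP => j; rewrite !ffunE.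
by case: eqP => //; rewrite scaler0 addr0.
Qed.
HB.instance Definition _ i :=
  GRing.isLinear.Build K E {ffun I -> E} _ (single i) (single_is_linear i).

Definition prodv : {vspace {ffun I -> E}} :=
  (\bigcap_i (linfun (eval_at i) @^-1: F i))%VS.

Lemma prodvP (f : {ffun I -> E}) : reflect (forall i, f i \in F i) (f \in prodv).
Proof.
rewrite memvE; apply: (iffP subv_bigcapP) => h i.
  by have := h i isT; rewrite -memvE -memv_preim lfunE.
by move=> _; rewrite -memvE -memv_preim lfunE; exact: h.
Qed.

Lemma dim_prodv : \dim prodv = (\sum_i \dim (F i))%N.
Proof.
have -> : prodv = (\sum_i linfun (single i) @: F i)%VS.
  apply/vspaceP => f; apply/prodvP/memv_sumP => [fF|[u uF ->] i].
    exists (fun i => single i (f i)) => [i _|].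
      by apply/memv_imgP; exists (f i); rewrite ?lfunE.
    apply/ffunP => j; rewrite sum_ffunE (bigD1 j) //= ffunE eqxx.
    by rewrite big1 ?addr0 // => i ij; rewrite ffunE eq_sym (negPf ij).
  rewrite sum_ffunE; apply: memv_suml => j _.
  have /memv_imgP[x xF ->] := uF j isT; rewrite lfunE ffunE.
  by case: eqP => [->|_]; rewrite ?mem0v.
have /directvP -> : directv (\sum_i linfun (single i) @: F i).
  apply/directv_sum_independent => u uF u0 i _.
  have /memv_imgP[x xF ux] := uF i isT; rewrite ux lfunE /=.
  suff -> : x = 0 by rewrite linear0.
  move/ffunP/(_ i): u0; rewrite sum_ffunE (bigD1 i) //= big1 ?addr0.
    by rewrite ux lfunE !ffunE eqxx.
  move=> j ji; have /memv_imgP[y yF ->] := uF j isT.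
  by rewrite lfunE ffunE eq_sym (negPf ji).
apply: eq_bigr => i _; apply: limg_dim_eq; apply/eqP.
rewrite -subv0; apply/subvP => x; rewrite memv_cap memv_ker lfunE /= memv0.
by case/andP=> _ /eqP/ffunP/(_ i); rewrite !ffunE eqxx => ->.
Qed.

End ProductSpace.

Section IndependenceModulo.
Variables (K : fieldType) (vT : vectType K).
Implicit Types (U V : {vspace vT}).

Definition indep_mod U r (z : 'I_r -> vT) :=
  forall a : 'I_r -> K, \sum_(j < r) a j *: z j \in U -> forall j, a j = 0.

Lemma indep_mod_dim U V r (z : 'I_r -> vT) :
  indep_mod U z -> (U <= V)%VS -> (forall j, z j \in V) ->
  (r + \dim U <= \dim V)%N.
Proof.
move=> zU UV zV; pose X := [tuple z j | j < r].
have Xj (j : 'I_r) : X`_j = z j by rewrite -tnth_nth tnth_mktuple.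
have fX : free X.
  apply/freeP => a e j; apply: zU => {j}.
  rewrite (eq_bigr (fun j : 'I_r => a j *: X`_j)) ?e ?mem0v // => j _.
  by rewrite Xj.
have XU0 : (<<X>> :&: U)%VS = 0%VS.
  apply/eqP; rewrite -subv0; apply/subvP => x; rewrite memv_cap memv0.
  case/andP => /coord_span -> xU; rewrite big1 // => j _.
  rewrite (zU (coord X ^~ x)) ?scale0r //; move: xU.
  by rewrite (eq_bigr (fun j : 'I_r => coord X j x *: z j)) // => i _; rewrite Xj.
have <- : \dim <<X>> = r by rewrite (eqP fX) size_tuple.
rewrite -dimv_disjoint_sum //; apply: dimvS; rewrite subv_add UV andbT.
by apply/span_subvP => _ /mapP[j _ ->].
Qed.

(** Greedy choice: a vector is kept when it lies outside the sum of U and the span of those after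
    it. It serves to pick a maximal family of homology classes among given cycles. *)
Lemma extract_indep U (X : seq vT) : exists r (z : 'I_r -> vT),
  [/\ forall j, z j \in X, indep_mod U z & (r + \dim U)%N = \dim (U + <<X>>)].
Proof.
elim: X => [|x X [r [z [zX zU rU]]]].
  by exists 0%N, (fun=> 0); split; [case | move=> a _ [] | rewrite span_nil addv0].
rewrite span_cons addvA [(U + _)%VS]addvC -addvA; have [xX|xX] := boolP (x \in U + <<X>>)%VS.
  exists r, z; split=> // [j|]; first by rewrite inE zX orbT.
  by have /addv_idPr -> : (<[x]> <= U + <<X>>)%VS by rewrite -memvE.
exists r.+1, (fun j => oapp z x (unlift ord0 j)); split=> [j|a|].
- by case: unliftP => [i _|_] /=; rewrite inE ?eqxx ?zX ?orbT.
- rewrite big_ord_recl unlift_none /=.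
  rewrite (eq_bigr (fun j : 'I_r => a (lift ord0 j) *: z j)) => [|j _]; last by rewrite liftK.
  move=> aU; have a0 : a ord0 = 0.
    apply: contraNeq xX => a0; set y := \sum_(j < r) _ in aU.
    have -> : x = (a ord0)^-1 *: (a ord0 *: x + y) - (a ord0)^-1 *: y.
      by rewrite scalerDr addrK scalerA mulVf // scale1r.
    apply: memvB; apply: memvZ.
      by rewrite memvE in aU *; apply: subv_trans aU _; exact: addvSl.
    have : y \in <<X>>%VS by apply: memv_suml => j _; apply/memvZ/memv_span.
    by rewrite !memvE => h; apply: subv_trans h _; exact: addvSr.
  move: aU; rewrite a0 scale0r add0r => /zU h j.
  by case: (unliftP ord0 j) => [i ->|->].
rewrite dimv_disjoint_sum ?dim_vline.
  rewrite -rU; have -> : x != 0 by apply: contraNneq xX => ->; exact: mem0v.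
  by rewrite addSn.
apply/eqP; rewrite -subv0; apply/subvP => y; rewrite memv_cap memv0.
case/andP => /vlineP[b ->]; have [->|b0 bX] := eqVneq b 0; first by rewrite scale0r.
by move/(memvZ b^-1): bX; rewrite scalerA mulVf // scale1r (negPf xX).
Qed.

End IndependenceModulo.

Section ChainSpace.
Variables (K : fieldType) (E : vectType K) (d : Order.disp_t) (T : finPOrderType d).
Implicit Types (A : {set T}) (j : nat).

Definition bdf (c : {ffun {set T} -> E}) : {ffun {set T} -> E} :=
  [ffun t => bd c t].
Lemma bdf_is_linear : linear bdf.
Proof.
move=> a c c'; apply/ffunP => t; rewrite !ffunE /bd scaler_sumr -big_split.
apply: eq_bigr => x _ /=.
by rewrite !ffunE scalerDr !scalerA mulrC.
Qed.
HB.instance Definition _ :=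
  GRing.isLinear.Build K {ffun {set T} -> E} {ffun {set T} -> E} _ bdf bdf_is_linear.

(** The index j is the size of the simplices, one more than the homological degree. *)
Definition chains A j : {vspace {ffun {set T} -> E}} :=
  prodv (fun s => if (s \in order_complex A) && (#|s| == j) then fullv else 0%VS).

Lemma chainsP A j (c : {ffun {set T} -> E}) :
  reflect (forall s, c s != 0 -> s \in order_complex A /\ #|s| = j) (c \in chains A j).
Proof.
apply: (iffP (prodvP _ _)) => h s.
  by have := h s; case: ifP => [/andP[sA /eqP sj] //|_]; rewrite memv0 => ->.
case: ifP => [_|/negbT sA]; first exact: memvf.
rewrite memv0; apply: contraNT sA => /h[-> /eqP->] //.
Qed.

Definition cycles A j := (chains A j :&: lker (linfun bdf))%VS.
Definition bounds A j := (linfun bdf @: chains A j.+1)%VS.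

Lemma cyclesP A j (c : {ffun {set T} -> E}) :
  reflect (c \in chains A j /\ bdf c = 0) (c \in cycles A j).
Proof.
by rewrite memv_cap memv_ker lfunE; apply: (iffP andP) => -[-> /eqP].
Qed.

Lemma boundsP A j (c : {ffun {set T} -> E}) :
  reflect (exists2 b, b \in chains A j.+1 & c = bdf b) (c \in bounds A j).
Proof.
by apply: (iffP memv_imgP) => -[b bA ->]; exists b; rewrite ?lfunE.
Qed.

Lemma bdf_chains A j (c : {ffun {set T} -> E}) : c \in chains A j.+1 -> bdf c \in chains A j.
Proof.
move/chainsP=> cA; apply/chainsP => s; rewrite ffunE => /bd_neq0[x xs /cA[]].
rewrite cardsU1 xs add1n => xsA [sj]; split=> //.
move: xsA; rewrite !inE subUset => /andP[/andP[_ ->] /forall_inP h] /=.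
apply/forall_inP => y ys; apply/forall_inP => w ws.
by have /forall_inP := h y (setU1r _ ys); apply; exact: setU1r.
Qed.

Lemma bdf_bdf A j (c : {ffun {set T} -> E}) : c \in chains A j -> bdf (bdf c) = 0.
Proof.
move/chainsP=> cA; apply/ffunP => t; rewrite !ffunE.
transitivity (bd (bd c) t); first by apply: eq_bd => x _; rewrite ffunE.
apply: bd_bd => s /cA[]; rewrite !inE => /andP[_ ->]; by rewrite subsetT.
Qed.

Lemma bounds_cycles A j : (bounds A j <= cycles A j)%VS.
Proof.
apply/subvP => c /boundsP[b bA ->]; apply/cyclesP.
by rewrite bdf_chains // (bdf_bdf bA).
Qed.

End ChainSpace.

(** * Coefficients in a vector space, coordinate by coordinate *)

Section Coordinates.
Variables (K : fieldType) (E : vectType K) (d : Order.disp_t) (T : finPOrderType d).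
Implicit Types (A : {set T}) (j : nat).

Let m := \dim {: E}.
Let e := vbasis {: E}.

Definition coords (f : {ffun {set T} -> E}) : {ffun 'I_m -> {ffun {set T} -> K^o}} :=
  [ffun a => [ffun s => coord e a (f s)]].
Lemma coords_is_linear : linear coords.
Proof.
move=> a f g; apply/ffunP => i; apply/ffunP => s; rewrite !ffunE linearD linearZ //.
Qed.
HB.instance Definition _ := GRing.isLinear.Build K {ffun {set T} -> E}
  {ffun 'I_m -> {ffun {set T} -> K^o}} _ coords coords_is_linear.

Definition assemble (g : {ffun 'I_m -> {ffun {set T} -> K^o}}) : {ffun {set T} -> E} :=
  [ffun s => \sum_a g a s *: e`_a].

Lemma assembleK : cancel assemble coords.
Proof.
move=> g; apply/ffunP => a; apply/ffunP => s; rewrite !ffunE.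
rewrite coord_sum_free //; apply: basis_free; exact: vbasisP.
Qed.

Lemma coordsK : cancel coords assemble.
Proof.
move=> f; apply/ffunP => s; rewrite ffunE [RHS](coord_vbasis (memvf _)).
by apply: eq_bigr => a _; rewrite !ffunE.
Qed.

Lemma coords_bdf f a : coords (bdf f) a = bdf (coords f a).
Proof.
apply/ffunP => s; rewrite !ffunE.
transitivity (bd (fun t => coord e a (f t) : K^o) s); first by rewrite -linear_bd.
by apply: eq_bd => x _; rewrite !ffunE.
Qed.

Lemma coords_chains A j f :
  (f \in chains E A j) = [forall a, coords f a \in chains K^o A j].
Proof.
apply/chainsP/forallP => [fA a|fA s fs].
  apply/chainsP => s; rewrite !ffunE => h; apply: fA.
  by apply: contra_neq h => ->; rewrite linear0.
apply: contrapT => ns; move/negP: fs; apply; apply/eqP.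
rewrite (coord_vbasis (memvf (f s))) big1 // => a _.
have [->|h] := eqVneq (coord (vbasis fullv) a (f s)) 0; first by rewrite scale0r.
by case: ns; move/chainsP: (fA a); apply; rewrite !ffunE.
Qed.

Lemma coords_cycles A j f :
  (f \in cycles E A j) = [forall a, coords f a \in cycles K^o A j].
Proof.
apply/cyclesP/forallP => [[fA df] a|fA].
  apply/cyclesP; rewrite -coords_bdf df; split.
    by move: fA; rewrite coords_chains => /forallP.
  by apply/ffunP => s; rewrite !ffunE linear0.
split; first by rewrite coords_chains; apply/forallP => a; have /cyclesP[] := fA a.
apply: (can_inj coordsK); apply/ffunP => a; rewrite coords_bdf.
by have /cyclesP[_ ->] := fA a; apply/ffunP => s; rewrite !ffunE linear0.
Qed.

Lemma coords_bounds A j f :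
  (f \in bounds E A j) = [forall a, coords f a \in bounds K^o A j].
Proof.
apply/boundsP/forallP => [[b bA ->] a|fA].
  apply/boundsP; exists (coords b a); last exact: coords_bdf.
  by move: bA; rewrite coords_chains => /forallP.
have /choice[b bP] : forall a, exists b, b \in chains K^o A j.+1 /\ coords f a = bdf b.
  by move=> a; have /boundsP[b bA e'] := fA a; exists b.
exists (assemble [ffun a => b a]).
  by rewrite coords_chains assembleK; apply/forallP => a; rewrite ffunE; have [] := bP a.
apply: (can_inj coordsK); apply/ffunP => a.
by rewrite coords_bdf assembleK (proj2 (bP a)) [X in _ = bdf X]ffunE.
Qed.

(** Applied to cycles and to boundaries, it makes homology with constant coefficients in E amount to
    m copies of the homology over K. *)
Lemma dim_coords (U : {vspace {ffun {set T} -> E}}) (V : {vspace {ffun {set T} -> K^o}}) :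
  (forall f, (f \in U) = [forall a, coords f a \in V]) -> \dim U = (m * \dim V)%N.
Proof.
move=> UV; have -> : (m * \dim V)%N = \dim (prodv (fun _ : 'I_m => V)).
  by rewrite dim_prodv sum_nat_const card_ord.
have -> : prodv (fun _ : 'I_m => V) = (linfun coords @: U)%VS.
  apply/vspaceP => g; apply/prodvP/memv_imgP => [gV|[f fU ge] a].
    exists (assemble g); first by rewrite UV assembleK; apply/forallP.
    by rewrite lfunE /= assembleK.
  have -> : g = coords f by rewrite ge lfunE.
  by move: fU; rewrite UV => /forallP.
apply/esym; apply: limg_dim_eq; apply/eqP; rewrite -subv0; apply/subvP => f.
rewrite memv_cap memv_ker lfunE memv0 /= => /andP[_ /eqP f0].
rewrite -(coordsK f) f0; apply/eqP/ffunP => s; rewrite !ffunE big1 // => a _.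
by rewrite !ffunE scale0r.
Qed.

End Coordinates.

(** * Extension of scalars *)

Lemma frac_num_den (R : idomainType) (x : {fraction R}) :
  exists2 q : R, q != 0 & exists p : R, FracField.tofrac q * x = FracField.tofrac p.
Proof.
elim/quotW: x => r; exists (\d_r); first exact: denom_ratioP.
exists (\n_r).
have d0 := denom_ratioP r.
rewrite !piE /FracField.mulf; apply/eqmodP; rewrite /= FracField.equivfE.
by rewrite !numden_Ratio ?(oner_eq0, mulf_neq0) // !mulr1 mul1r.
Qed.

Lemma common_denominator (R : idomainType) (I : finType) (x : I -> {fraction R}) :
  exists2 q : R, q != 0 &
    exists p : I -> R, forall i, FracField.tofrac q * x i = FracField.tofrac (p i).
Proof.
have /choice[f fP] : forall i, exists qp : R * R,
    qp.1 != 0 /\ FracField.tofrac qp.1 * x i = FracField.tofrac qp.2.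
  by move=> i; have [q q0 [p qx]] := frac_num_den (x i); exists (q, p).
exists (\prod_i (f i).1); first by apply/prodf_neq0 => i _; have [] := fP i.
exists (fun i => (\prod_(j | j != i) (f j).1) * (f i).2) => i.
rewrite (bigD1 i) //= mulrC !rmorphM /= mulrC -mulrA -(proj2 (fP i)).
by rewrite [RHS]mulrCA mulrA.
Qed.

Section Transfer.
Variables (k : idomainType) (d : Order.disp_t) (T : finPOrderType d).
Implicit Types (A : {set T}).

Let K : fieldType := {fraction {poly k}}.

Definition scalar (a : k) : K := FracField.tofrac a%:P.
HB.instance Definition _ := GRing.RMorphism.copy scalar (@FracField.tofrac _ \o polyC).

Definition embed (c : {ffun {set T} -> k^o}) : {ffun {set T} -> K^o} :=
  [ffun s => scalar (c s)].

Lemma boundaryE (R : idomainType) (c : {ffun {set T} -> R^o}) t :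
  boundary c t = bd c t.
Proof. by rewrite ffunE. Qed.

Lemma boundary_embed c : boundary (embed c) = embed (boundary c).
Proof.
apply/ffunP => t; rewrite !ffunE.
rewrite (rmorph_sum scalar); apply: eq_bigr => x _.
by rewrite ffunE (rmorphM scalar) (rmorphXn scalar) (rmorphN1 scalar).
Qed.

Lemma scalar_eq0 a : (scalar a == 0) = (a == 0).
Proof. by rewrite /scalar tofrac_eq0 polyC_eq0. Qed.

Lemma is_chain_embed A i c : is_chain A i (embed c) <-> is_chain A i c.
Proof.
split=> h s cs; apply: h; first by rewrite ffunE scalar_eq0.
by move: cs; rewrite ffunE scalar_eq0.
Qed.

Lemma is_cycle_embed A i c : is_cycle A i c -> is_cycle A i (embed c).
Proof.
case=> cA dc; split; first exact/is_chain_embed.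
by rewrite boundary_embed dc; apply/ffunP => s; rewrite !ffunE (rmorph0 scalar).
Qed.

Let X : K := FracField.tofrac 'X.

Lemma tofrac_poly m (p : {poly k}) : (size p <= m)%N ->
  FracField.tofrac p = \sum_(i < m) X ^+ i * scalar p`_i :> K.
Proof.
move=> pm; have {1}-> : p = \sum_(i < m) 'X^i * (p`_i)%:P.
  rewrite -[LHS]coefK poly_def (big_ord_widen m (fun i => p`_i *: 'X^i)) // big_mkcond.
  apply: eq_bigr => i _; rewrite mulrC mul_polyC.
  by case: ltnP => // h; rewrite nth_default ?scale0r.
by rewrite rmorph_sum; apply: eq_bigr => i _; rewrite rmorphM rmorphXn.
Qed.

Lemma boundary_bdf (c : {ffun {set T} -> K^o}) : boundary c = bdf c.
Proof. by apply/ffunP => t; rewrite !ffunE. Qed.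

Lemma is_chainP A j (c : {ffun {set T} -> K^o}) :
  is_chain A (j%:Z - 1) c <-> c \in chains K^o A j.
Proof.
rewrite /is_chain subrK; split=> [h|/chainsP h s /h[sA ->] //].
by apply/chainsP => s /h[sA []].
Qed.

Lemma is_chainP1 A j (c : {ffun {set T} -> K^o}) :
  is_chain A (j%:Z - 1 + 1) c <-> c \in chains K^o A j.+1.
Proof.
have -> : j%:Z - 1 + 1 = j.+1%:Z - 1 by rewrite subrK -addn1 PoszD addrK.
exact: is_chainP.
Qed.

Lemma is_cycleP A j (c : {ffun {set T} -> K^o}) :
  is_cycle A (j%:Z - 1) c <-> c \in cycles K^o A j.
Proof.
rewrite /is_cycle is_chainP boundary_bdf.
by split=> [?|/cyclesP//]; apply/cyclesP.
Qed.

(** The boundary has coefficients 1 and -1, hence commutes with extracting the coefficient of a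
    power of X. *)
Lemma poly_cycle A (i : int) (p : {set T} -> {poly k}) m :
  (forall s, p s != 0 -> s \in order_complex A /\ #|s|%:Z = i + 1) ->
  (forall t : {set T}, \sum_(x | x \notin t) (-1) ^+ position t x * p (x |: t) = 0) ->
  is_cycle A i ([ffun s => (p s)`_m] : {ffun {set T} -> k^o}).
Proof.
move=> pA dp; split=> [s|].
  by rewrite ffunE => h; apply: pA; apply: contra_neq h => ->; rewrite coef0.
apply/ffunP => t; rewrite !ffunE; move/(congr1 (fun q : {poly k} => q`_m)): (dp t).
rewrite coef_sum coef0 => e; rewrite -[RHS]e; apply: eq_bigr => x _.
rewrite ffunE -[in LHS]signr_odd -[in RHS]signr_odd.
by case: odd; rewrite ?expr1 ?expr0 ?mulN1r ?mul1r ?coefN.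
Qed.

(** An explicit form of the flatness of K over k: clear the denominators, then split the polynomial
    coefficients by powers of X. *)
Lemma cycle_embed A i (z : {ffun {set T} -> K^o}) : is_cycle A i z ->
  exists (q : K) m (c : 'I_m -> {ffun {set T} -> k^o}),
    [/\ q != 0, forall l, is_cycle A i (c l) &
      z = q *: \sum_(l < m) X ^+ l *: embed (c l)].
Proof.
case=> zA dz; have [q q0 [p pz]] := common_denominator z.
have q0' : FracField.tofrac q != 0 by rewrite tofrac_eq0.
exists (FracField.tofrac q)^-1, (\max_s size (p s)), (fun l => [ffun s => (p s)`_l]).
split=> [|l|]; first by rewrite invr_eq0.
  apply: poly_cycle => [s|t].
    by rewrite -(tofrac_eq0 (p s)) -pz mulf_eq0 (negPf q0') => /zA.
  apply/eqP; rewrite -tofrac_eq0 rmorph_sum /=; apply/eqP.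
  transitivity (FracField.tofrac q * boundary z t); last first.
    by rewrite dz ffunE mulr0.
  rewrite ffunE mulr_sumr; apply: eq_bigr => x _.
  by rewrite rmorphM /= -pz rmorph_sign mulrCA.
apply/ffunP => s; rewrite ffunE sum_ffunE.
apply: (scalerI q0'); rewrite scalerA mulfV // scale1r.
rewrite -[LHS]/(FracField.tofrac q * z s) pz (@tofrac_poly (\max_s size (p s))); last first.
  exact: leq_bigmax.
by apply: eq_bigr => l _; rewrite !ffunE.
Qed.

Lemma homology_vanishes_frac A i : homology_vanishes k A i -> homology_vanishes K A i.
Proof.
move=> h z /cycle_embed[q [m [c [q0 cA ->]]]].
have /choice[b bP] : forall l, exists b, is_chain A (i + 1) b /\ boundary b = c l.
  by move=> l; have [b bA db] := h _ (cA l); exists b.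
exists (q *: \sum_(l < m) X ^+ l *: embed (b l)) => [s|].
  rewrite ffunE sum_ffunE => h0.
  have [l bl] : exists l, b l s != 0.
    apply: contrapT => nex; move/negP: h0; apply; apply/eqP.
    rewrite big1 ?scaler0 // => l _; rewrite !ffunE.
    have [->|bl] := eqVneq (b l s) 0; last by case: nex; exists l.
    by rewrite (rmorph0 scalar) scaler0.
  by have [bA _] := bP l; exact: bA.
rewrite boundary_bdf linearZ linear_sum /=; congr (_ *: _).
apply: eq_bigr => l _; rewrite linearZ /= -boundary_bdf boundary_embed.
by have [_ ->] := bP l.
Qed.

(** The coefficients of a relation over K and of the chain bounding it are given one common
    denominator, whence the sum type. The resulting relation over k[X] splits by powers of X into
    relations over k. *)
Lemma indep_embed A j r (z : 'I_r -> {ffun {set T} -> k^o}) :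
  (forall a : 'I_r -> k, is_boundary A (j%:Z - 1) (\sum_(l < r) a l *: z l) ->
     forall l, a l = 0) ->
  indep_mod (bounds K^o A j) (fun l => embed (z l)).
Proof.
move=> zI a /boundsP[c cA dc].
have [q q0 [p pP]] := common_denominator
  (fun u : 'I_r + {set T} => match u with inl l => a l | inr s => c s end).
have q0' : FracField.tofrac q != 0 by rewrite tofrac_eq0.
have pE t : \sum_l p (inl l) * (z l t)%:P =
    \sum_(x | x \notin t) (-1) ^+ position t x * p (inr (x |: t)).
  apply/eqP; rewrite -tofrac_eq !rmorph_sum /=; apply/eqP.
  transitivity (FracField.tofrac q * (\sum_(l < r) a l *: embed (z l)) t).
    rewrite sum_ffunE mulr_sumr; apply: eq_bigr => l _.
    by rewrite rmorphM /= -(pP (inl l)) !ffunE mulrA.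
  rewrite dc ffunE mulr_sumr; apply: eq_bigr => x _.
  by rewrite rmorphM /= -(pP (inr _)) rmorph_sign mulrCA.
suff p0 l : p (inl l) = 0.
  move=> l; apply/eqP; rewrite -(mulrI_eq0 _ (mulfI q0')) (pP (inl l)).
  by rewrite p0 tofrac0.
apply/polyP => m; rewrite coef0; apply: (zI (fun l => (p (inl l))`_m)) => {l}.
exists [ffun s => (p (inr s))`_m].
  move/is_chainP1: cA => cA s; rewrite ffunE => h; apply: cA.
  have p0 : p (inr s) != 0 by apply: contra_neq h => ->; rewrite coef0.
  by move: p0; rewrite -tofrac_eq0 -(pP (inr s)) mulf_eq0 negb_or => /andP[].
apply/ffunP => t; rewrite sum_ffunE ffunE.
move/(congr1 (fun f : {poly k} => f`_m)): (pE t); rewrite !coef_sum => e.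
transitivity (\sum_l (p (inl l) * (z l t)%:P)`_m).
  rewrite e; apply: eq_bigr => x _; rewrite ffunE.
  rewrite -[in LHS]signr_odd -[in RHS]signr_odd.
  by case: odd; rewrite ?expr1 ?expr0 ?mulN1r ?mul1r ?coefN.
by apply: eq_bigr => l _; rewrite coefMC ffunE.
Qed.

Lemma cycles_span A j : exists B : seq {ffun {set T} -> K^o},
  (forall x, x \in B -> exists2 c, is_cycle A (j%:Z - 1) c & x = embed c) /\
  (cycles K^o A j <= <<B>>)%VS.
Proof.
suff main (Y : seq {ffun {set T} -> K^o}) : {subset Y <= cycles K^o A j} ->
    exists B : seq {ffun {set T} -> K^o},
    (forall x, x \in B -> exists2 c, is_cycle A (j%:Z - 1) c & x = embed c) /\
    {subset Y <= <<B>>%VS}.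
  have [|B [XA YX]] := main (vbasis (cycles K^o A j)); first by move=> x /vbasis_mem.
  exists B; split=> //; rewrite -(span_basis (vbasisP (cycles K^o A j))).
  exact/span_subvP.
elim: Y => [|y Y IH] YA; first by exists [::]; split.
have [|B [XA YX]] := IH; first by move=> x xY; apply: YA; rewrite inE xY orbT.
have /is_cycleP/cycle_embed[q [m [c [q0 cA yc]]]] := YA y (mem_head _ _).
exists ([seq embed (c l) | l : 'I_m] ++ B); split=> x.
  by rewrite mem_cat => /orP[/mapP[l _ ->]|/XA//]; exists (c l).
rewrite inE => /orP[/eqP->|/YX xX]; last first.
  by rewrite span_cat memvE; apply: subv_trans (addvSr _ _).
rewrite yc; apply: memvZ; apply: memv_suml => l _; apply: memvZ.
by apply: memv_span; rewrite mem_cat; apply/orP; left; apply/imageP; exists l.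
Qed.

(** Classes independent over k stay independent over K, which bounds [betti] from above. Conversely
    the embedded k-cycles span the K-cycles, so a maximal family independent modulo boundaries can
    be chosen among them. *)
Lemma betti_dim A j :
  (betti k A (j%:Z - 1) + \dim (bounds K^o A j))%N = \dim (cycles K^o A j).
Proof.
set i := j%:Z - 1.
have upper r : has_indep_classes k A i r ->
    (r + \dim (bounds K^o A j) <= \dim (cycles K^o A j))%N.
  case=> z zA /indep_embed zI; apply: (indep_mod_dim zI); first exact: bounds_cycles.
  by move=> l; apply/is_cycleP/is_cycle_embed.
have [B [XA ZX]] := cycles_span A j.
have [r [z [zX zI rB]]] := extract_indep (bounds K^o A j) B.
have XZ : (<<B>> <= cycles K^o A j)%VS.
  by apply/span_subvP => x /XA[c /is_cycle_embed/is_cycleP cA ->].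
have rZ : (r + \dim (bounds K^o A j))%N = \dim (cycles K^o A j).
  rewrite rB; congr (\dim _); apply/eqP; rewrite eqEsubv subv_add bounds_cycles XZ /=.
  by apply: subv_trans ZX _; exact: addvSr.
have /choice[c cP] : forall l, exists c, is_cycle A i c /\ z l = embed c.
  by move=> l; have [c cA e] := XA _ (zX l); exists c.
have rI : has_indep_classes k A i r.
  exists c => [l|a [b bA db] l]; first by have [] := cP l.
  apply/eqP; rewrite -scalar_eq0; apply/eqP.
  apply: (zI (fun l => scalar (a l))); apply/boundsP; exists (embed b).
    by apply/is_chainP1/is_chain_embed.
  rewrite -boundary_bdf boundary_embed db; apply/ffunP => s.
  rewrite !ffunE !sum_ffunE (rmorph_sum scalar); apply: eq_bigr => i' _.
  by rewrite (proj2 (cP _)) !ffunE (rmorphM scalar).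
suff -> : betti k A i = r by [].
apply/eqP; rewrite eqn_leq; apply/andP; split.
  apply/bigmax_leqP => r' /asboolP/upper.
  by rewrite -rZ leq_add2r.
have rN : (r < #|{set T}|.+1)%N.
  rewrite ltnS; apply: leq_trans (leq_addr (\dim (bounds K^o A j)) r) _.
  rewrite rZ; apply: leq_trans (dimvS (subvf _)) _.
  by rewrite dimvf /dim /= muln1.
by apply: (leq_bigmax_cond (Ordinal rN)); apply/asboolP.
Qed.

End Transfer.

(** * Chains of faces sorted by their largest element *)

Section Top.
Variables (d : Order.disp_t) (S : finBPOrderType d) (hS : simplicial_poset S).
Implicit Types (x y : S) (s t : {set S}).

Local Notation OC := (order_complex (up \bot%O)).

Definition is_top s x := (x \in s) && [forall y in s, (y <= x)%O].
Definition top s : S := odflt \bot%O [pick x | is_top s x].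

Lemma top_eq s x : is_top s x -> top s = x.
Proof.
move=> xs; rewrite /top; case: pickP => [y ys|/(_ x)/=]; last by rewrite xs.
move: xs ys => /andP[xs /forall_inP hx] /andP[ys /forall_inP hy] /=.
by apply/eqP; rewrite eq_le hx // hy.
Qed.

Lemma top0 : top set0 = \bot%O.
Proof. by rewrite /top; case: pickP => [x|]; rewrite /is_top ?inE. Qed.

Lemma topP s : s \in OC -> s != set0 -> is_top s (top s).
Proof.
rewrite inE => /andP[_ /forall_inP h] /set0Pn[x0 x0s].
have [x xs xmax] := arg_maxnP (P := fun x => x \in s) (fun x => #|verts x|) x0s.
suff xP : is_top s x by rewrite (top_eq xP).
rewrite /is_top xs; apply/forall_inP => y ys.
have /forall_inP/(_ y ys)/orP[] := h x xs => //.
rewrite le_eqVlt => /orP[/eqP->//|/(verts_lt hS)/proper_card].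
by rewrite ltnNge => /negP[]; exact: xmax.
Qed.

Lemma vset_top s : s \in OC -> vset s = verts (top s).
Proof.
move=> sO; have [->|s0] := eqVneq s set0.
  by rewrite top0 verts0 /vset big_set0.
have /andP[ts /forall_inP tm] := topP sO s0.
apply/eqP; rewrite eqEsubset; apply/andP; split.
  by apply/bigcupsP => x xs; apply: vertsS; exact: tm.
exact: (bigcup_sup (top s)).
Qed.

Lemma top_in s : s \in OC -> top s != \bot%O -> top s \in s.
Proof.
move=> sO; have [->|s0] := eqVneq s set0; first by rewrite top0 eqxx.
by have /andP[] := topP sO s0.
Qed.

Lemma le_top s x : s \in OC -> x \in s -> (x <= top s)%O.
Proof.
move=> sO xs; have /(topP sO)/andP[_ /forall_inP] : s != set0.
  by apply/set0Pn; exists x.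
exact.
Qed.

Lemma top_add s x : s \in OC -> (top s < x)%O ->
  [/\ x |: s \in OC, top (x |: s) = x & x \notin s].
Proof.
move=> sO tx; have sx y : y \in s -> (y < x)%O.
  by move=> ys; apply: le_lt_trans tx; exact: le_top.
split.
- rewrite order_complexU1 sO [x \in _]inE (le_lt_trans (le0x _) tx) /=.
  by apply/forall_inP => y /sx/ltW->; rewrite orbT.
- apply: top_eq; rewrite /is_top setU11; apply/forall_inP => y.
  by rewrite !inE => /orP[/eqP->|/sx/ltW].
by apply/negP => /sx; rewrite ltxx.
Qed.

Lemma top_remove s : s \in OC -> top s != \bot%O ->
  s :\ top s \in OC /\ (top (s :\ top s) < top s)%O.
Proof.
move=> sO t0; have s'O : s :\ top s \in OC by apply: order_complexS sO; exact: subD1set.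
split=> //; have [->|t'0] := eqVneq (top (s :\ top s)) \bot%O; first by rewrite lt0x.
have := top_in s'O t'0; rewrite in_setD1 => /andP[ne ts].
by rewrite lt_neqAle ne le_top.
Qed.

Lemma card_le_verts s : s \in OC -> (#|s| <= #|verts (top s)|)%N.
Proof.
elim: {s}#|s| {-2}s (erefl #|s|) => [|m IHm] s sm sO.
  by rewrite sm.
rewrite sm.
have t0 : top s != \bot%O.
  apply: contra_eq_neq sm => t0.
  have [->|s0] := eqVneq s set0; first by rewrite cards0.
  have /andP[ts _] := topP sO s0; move: sO; rewrite inE => /andP[/subsetP/(_ _ ts)].
  by rewrite inE t0 ltxx.
have [s'O lt] := top_remove sO t0.
have cs : #|s :\ top s| = m by have := cardsD1 (top s) s; rewrite sm top_in // => -[].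
by apply: leq_ltn_trans (proper_card (verts_lt hS lt)); rewrite -{1}cs; exact: IHm.
Qed.

(** In essence the Euler characteristic of the subdivided boundary of a simplex: removing x leaves a
    chain with top y < x, and [mobius] evaluates the sum over y. *)
Lemma alternating_chains x :
  \sum_(s in OC | top s == x) (-1) ^+ #|s| = (-1) ^+ #|verts x| :> int.
Proof.
elim: {x}#|verts x|.+1 {-2}x (ltnSn #|verts x|) => // m IHm x; rewrite ltnS => xm.
have [->|x0] := eqVneq x \bot%O.
  rewrite verts0 cards0 expr0 (big_pred1 set0) ?cards0 // => s.
  apply/andP/eqP => [[sO /eqP t0]|->].
    apply: contrapT => /eqP s0; have /andP[ts _] := topP sO s0.
    by move: sO; rewrite inE => /andP[/subsetP/(_ _ ts)]; rewrite inE t0 ltxx.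
  by rewrite top0 eqxx inE sub0set; split=> //; apply/forall_inP => y; rewrite inE.
rewrite (reindex_onto (fun s => x |: s) (fun s => s :\ x)) /=; last first.
  by move=> s /andP[sO /eqP tx]; rewrite setD1K // -tx top_in // tx.
have E s : ((x |: s \in OC) && (top (x |: s) == x) && ((x |: s) :\ x == s)) =
    (s \in OC) && (top s < x)%O.
  apply/idP/andP => [/andP[/andP[xsO /eqP tx] /eqP e]|[sO tx]].
    by have [] := top_remove xsO; rewrite tx // e.
  by have [-> -> xs] := top_add sO tx; rewrite eqxx setU1K ?eqxx.
rewrite (eq_bigl _ _ E).
transitivity (- \sum_(s in OC | (top s < x)%O) (-1) ^+ #|s| : int).
  rewrite -sumrN; apply: eq_bigr => s /andP[sO tx].
  by have [_ _ xs] := top_add sO tx; rewrite cardsU1 xs exprS mulN1r.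
rewrite (partition_big top (fun y => (y < x)%O)) /=; last by move=> s /andP[].
apply/eqP; rewrite -subr_eq0 -opprD oppr_eq0 addrC; apply/eqP.
rewrite -[RHS](mobius hS x0) [RHS](bigD1 x) //=; congr (_ + _).
apply: eq_big => [y|y yx]; first by rewrite lt_neqAle andbC.
rewrite -IHm; last by apply: leq_trans (proper_card (verts_lt hS yx)) xm.
apply: eq_bigl => s; case: (_ \in _) => //=.
by case: eqP => [->|]; rewrite ?andbF // yx.
Qed.

End Top.

(** * Counting dimensions *)

Lemma alternating_sum (a : nat -> int) i :
  \sum_(j < i.+2) (-1) ^+ (i.+1 - j) * a j =
  a i.+1 - \sum_(j < i.+1) (-1) ^+ (i - j) * a j.
Proof.
rewrite big_ord_recr /= subnn expr0 mul1r addrC; congr (_ + _).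
rewrite -sumrN; apply: eq_bigr => j _.
have ji : (j <= i)%N by rewrite -ltnS.
by rewrite subSn // exprS mulN1r mulNr.
Qed.

Section Kappa.
Variables (K : fieldType) (n : nat) (V : finType) (pt : V -> K).
Variables (d : Order.disp_t) (T : finPOrderType d) (A : {set T}).
Variables (VS : {set T} -> {set V}) (r : nat).
Hypothesis VS_mono : forall s t : {set T}, s \subset t -> VS s \subset VS t.
Hypothesis exactness : forall j (z : {set T} -> ext K n r),
  (j + r <= n)%N -> supported A VS j set0 z ->
  (forall s, bd z s \in ann n pt r (VS s)) ->
  exists2 y : {set T} -> ext K n r, supported A VS j.+1 set0 y &
    forall s, z s - bd y s \in ann n pt r (VS s).

Let E := ext K n r.

Definition ann_chains j : {vspace {ffun {set T} -> E}} :=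
  prodv (fun s => if (s \in order_complex A) && (#|s| == j)
                  then ann n pt r (VS s) else 0%VS).

Definition kappa j := \dim (bounds E A j :&: ann_chains j).

Lemma ann_chainsP j (c : {ffun {set T} -> E}) :
  reflect (c \in chains E A j /\ forall s, c s \in ann n pt r (VS s))
    (c \in ann_chains j).
Proof.
apply: (iffP (prodvP _ _)) => [h|[/chainsP cA cann] s].
  split=> [|s].
    apply/chainsP => s cs; have := h s; case: ifP => [/andP[sA /eqP sj] //|_].
    by rewrite memv0 (negPf cs).
  have := h s; case: ifP => // _; rewrite memv0 => /eqP->; exact: mem0v.
case: ifP => // /negbT sA; rewrite memv0; apply: contraNT sA => /cA[-> ->].
by rewrite eqxx.
Qed.

Lemma supported_chains j (c : {ffun {set T} -> E}) :
  c \in chains E A j <-> supported A VS j set0 c.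
Proof.
split=> [/chainsP h s /h[sA sj]|h]; first by rewrite sub0set.
by apply/chainsP => s /h[].
Qed.

Lemma exact_chains j (c : {ffun {set T} -> E}) : (j + r <= n)%N ->
  c \in chains E A j -> (forall s, bdf c s \in ann n pt r (VS s)) ->
  exists2 b, b \in chains E A j.+1 & c - bdf b \in ann_chains j.
Proof.
move=> jr cA dc; have [|s|y yP cy] := exactness (z := c) jr.
- exact/supported_chains.
- by have := dc s; rewrite ffunE.
have yE : bdf (finfun y) = [ffun s => bd y s].
  by apply/ffunP => s; rewrite !ffunE; apply: eq_bd => x _; rewrite ffunE.
have yA : finfun y \in chains E A j.+1.
  by apply/chainsP => s; rewrite ffunE => /yP[].
exists (finfun y) => //; apply/ann_chainsP; split.
  by apply: memvB => //; exact: bdf_chains.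
by move=> s; rewrite yE !ffunE; exact: cy.
Qed.

(** A cycle with constant coefficients is a cycle modulo G, so by exactness the cycles are the sum
    of the boundaries and of the cycles in G; [kappa j] is the dimension of the overlap. *)
Lemma dim_cycles_kappa j : (j + r <= n)%N ->
  (\dim (cycles E A j) + kappa j)%N =
  (\dim (bounds E A j) + \dim (ann_chains j :&: cycles E A j))%N.
Proof.
move=> jr; rewrite -[RHS]dimv_sum_cap /kappa; congr addn; congr dimv.
  apply/eqP; rewrite eqEsubv subv_add bounds_cycles capvSr andbT andbT.
  apply/subvP => c /[dup] /cyclesP[cA dc] cZ.
  have [|b bA cb] := exact_chains jr cA.
    by move=> s; rewrite dc ffunE mem0v.
  rewrite -(subrK (bdf b) c) addrC; apply: memv_add.
    by apply/boundsP; exists b.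
  rewrite memv_cap cb memvB //.
  by apply: (subvP (bounds_cycles _ _ _)); apply/boundsP; exists b.
apply/vspaceP => c; rewrite memv_cap [RHS]memv_cap.
have [cB|//] := boolP (c \in bounds E A j).
by rewrite [in RHS]memv_cap (subvP (bounds_cycles _ _ _) _ cB) andbT.
Qed.

Lemma ann_chains_ker j :
  (ann_chains j :&: lker (linfun (@bdf K E d T)) = ann_chains j :&: cycles E A j)%VS.
Proof.
apply/vspaceP => c; rewrite !memv_cap; have [/ann_chainsP[cA _]|//] := boolP (c \in ann_chains j).
by rewrite cA.
Qed.

Lemma dim_ann_chains0 : (r <= n)%N ->
  (\dim (ann_chains 0) + \dim (bounds E A 0))%N = (\dim (cycles E A 0) + kappa 0)%N.
Proof.
move=> rn; rewrite dim_cycles_kappa // addnC -ann_chains_ker.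
rewrite -(limg_ker_dim (linfun (@bdf K E d T)) (ann_chains 0)).
suff /eqP-> : (linfun (@bdf K E d T) @: ann_chains 0%N == 0)%VS by rewrite dimv0 addn0.
rewrite -subv0; apply/subvP => _ /memv_imgP[c /ann_chainsP[/chainsP cA _] ->].
rewrite memv0 lfunE /=; apply/eqP/ffunP => t; rewrite !ffunE bd_eq0 // => x _.
by apply/eqP/contraT => /cA[_ /eqP]; rewrite cards_eq0 setU_eq0 -cards_eq0 cards1.
Qed.

(** Rank-nullity on [ann_chains j.+1]. The image is the whole space measured by [kappa j]: if
    [bdf b] lies in G, then b is a cycle modulo G, and exactness replaces it by a chain in G with
    the same boundary. *)
Lemma dim_ann_chainsS j : (j.+1 + r <= n)%N ->
  (\dim (ann_chains j.+1) + \dim (bounds E A j.+1))%N =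
  (\dim (cycles E A j.+1) + kappa j.+1 + kappa j)%N.
Proof.
move=> jr; rewrite dim_cycles_kappa // -addnA addnC -ann_chains_ker; congr (_ + _)%N.
rewrite -(limg_ker_dim (linfun (@bdf K E d T)) (ann_chains j.+1)); congr addn; congr dimv.
apply/vspaceP => c; rewrite memv_cap; apply/memv_imgP/andP => [[b /ann_chainsP[bA bann] ->]|].
  rewrite lfunE /=; split; first by apply/boundsP; exists b.
  apply/ann_chainsP; split; first exact: bdf_chains.
  move=> s; rewrite ffunE; apply: memv_suml => x _; apply/memvZ.
  by apply: annS (bann _); apply/VS_mono/subsetUr.
case=> /boundsP[b bA ->] /ann_chainsP[_ dann].
have [e eA be] := exact_chains jr bA dann.
exists (b - bdf e) => //.
by rewrite lfunE /= linearB /= (bdf_bdf eA) subr0.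
Qed.

(** Each [kappa j] enters the counts for sizes j and j + 1, with opposite signs; only the last one
    survives. *)
Lemma alternating_ann_chains i : (i + r <= n)%N ->
  \sum_(j < i.+1) (-1) ^+ (i - j) * (\dim (ann_chains j))%:Z =
  \sum_(j < i.+1) (-1) ^+ (i - j) * ((\dim (cycles E A j))%:Z - (\dim (bounds E A j))%:Z)
  + (kappa i)%:Z.
Proof.
elim: i => [|i IHi] ir.
  rewrite !big_ord1 /= !expr0 !mul1r addrAC; apply/eqP; rewrite eq_sym subr_eq; apply/eqP.
  by rewrite -!PoszD dim_ann_chains0.
rewrite (alternating_sum (fun j => (\dim (ann_chains j))%:Z)).
rewrite (alternating_sum (fun j => (\dim (cycles E A j))%:Z - (\dim (bounds E A j))%:Z)).
rewrite IHi; last exact: leq_trans ir.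
have := dim_ann_chainsS ir; lia.
Qed.

End Kappa.

Lemma coef_exp_1subX m c : ((1 - 'X : {poly int}) ^+ m)`_c = (-1) ^+ c * 'C(m, c)%:Z.
Proof.
rewrite exprBn coef_sum.
under eq_bigr do rewrite expr1n mulr1 coefMn -(rmorph_sign polyC) coefCM coefXn.
have [cm|cm] := ltnP c m.+1.
  rewrite (bigD1 (Ordinal cm)) //= eqxx mulr1 big1 ?addr0 => [|l lc].
    by rewrite -mulr_natr natz.
  by rewrite (_ : (c == l) = false) ?mulr0 ?mul0rn //; apply/negbTE; rewrite eq_sym.
rewrite bin_small // mulr0 big1 // => l _.
by rewrite gtn_eqF ?mulr0 ?mul0rn // (leq_trans (ltn_ord l)).
Qed.

Section FaceNumbers.
Variables (d : Order.disp_t) (S : finBPOrderType d) (hS : simplicial_poset S) (n : nat).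
Hypothesis card_n : forall x : S, (#|verts x| <= n)%N.

Local Notation OC := (order_complex (up (\bot%O : S))).

(** Expanding the h-polynomial gives a signed sum of binomials over the faces; [alternating_chains]
    spreads each face over the chains having it as top. *)
Lemma h_numE i : (i <= n)%N ->
  h_num hS n i = \sum_(s in OC) (-1) ^+ (i + #|s|) * 'C(n - #|vset s|, n - i)%:Z.
Proof.
move=> ni; pose g l : int := (-1) ^+ (i + l) * 'C(n - l, n - i)%:Z.
transitivity (\sum_(x : S) g #|verts x|).
  rewrite /h_num /h_poly coef_sum.
  rewrite (partition_big (fun x : S => inord #|verts x| : 'I_n.+1) xpredT) //=.
  apply: eq_bigr => l _; have ln : (l <= n)%N by rewrite -ltnS.
  rewrite coefZ (eq_bigr (fun=> g l)) => [|x /eqP <-]; last by rewrite inordK // ltnS.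
  have -> : ('X^l * (1 - 'X) ^+ (n - l))`_i = g l.
    rewrite coefXnM coef_exp_1subX /g; case: ltnP => il.
      by rewrite bin_small ?mulr0 //; lia.
    have -> : (n - i = (n - l) - (i - l))%N by lia.
    rewrite bin_sub; last by lia.
    have -> : (i + l = (i - l) + l.*2)%N by lia.
    by rewrite exprD -mul2n exprM sqrrN !expr1n mulr1.
  rewrite sumr_const -mulr_natl natz; congr (_%:Z * _).
  rewrite /f_num cardsE; apply: eq_card => x.
  change ((face_dim hS x == l%:Z - 1) = (inord #|verts x| == l :> 'I_n.+1)).
  rewrite /face_dim (inj_eq (addIr _)).
  by rewrite -val_eqE /= inordK ?ltnS // (card_verts hS) eqz_nat.
rewrite (partition_big (@top _ S) xpredT) //=; apply: eq_bigr => x _.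
rewrite /g exprD -(alternating_chains hS x) mulrAC mulr_sumr.
by apply: eq_bigr => s /andP[sO /eqP tx]; rewrite exprD (vset_top hS sO) tx mulrAC.
Qed.

Lemma h_num_ann (K : fieldType) (pt : S -> K) i : injective pt -> (i <= n)%N ->
  h_num hS n i = \sum_(j < i.+1)
    (-1) ^+ (i - j) * (\dim (ann_chains n pt (up \bot%O) (@vset _ S) (n - i) j))%:Z.
Proof.
move=> pt_inj ni; rewrite h_numE //.
transitivity (\sum_(j < i.+1) \sum_(s in OC | #|s| == j)
    (-1) ^+ (i + #|s|) * 'C(n - #|vset s|, n - i)%:Z).
  (* A chain with more than i members has more than i vertices, so its binomial coefficient
     vanishes. *)
  rewrite [LHS](bigID (fun s : {set S} => (#|s| < i.+1)%N)) /= [X in _ + X]big1 ?addr0.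
    rewrite (partition_big (fun s : {set S} => inord #|s| : 'I_i.+1) xpredT) //=.
    apply: eq_bigr => j _; apply: eq_bigl => s.
    rewrite -andbA; congr (_ && _); apply/andP/eqP => [[si /eqP <-]|->].
      by rewrite inordK.
    by rewrite ltn_ord inord_val.
  move=> s /andP[sO]; rewrite -leqNgt => si.
  have := card_le_verts hS sO; rewrite -(vset_top hS sO) => sv.
  have := card_n (top s); rewrite -(vset_top hS sO) => vn.
  rewrite bin_small ?mulr0 //.
  by apply: ltn_sub2l; [exact: leq_trans (leq_trans si sv) vn | exact: leq_trans si sv].
apply: eq_bigr => j _; have ji : (j <= i)%N by rewrite -ltnS.
rewrite dim_prodv big_mkcond /= (big_morph Posz PoszD (erefl _)) mulr_sumr.
apply: eq_bigr => s _; case: ifP => [/andP[sO /eqP sj]|_]; last by rewrite dimv0 mulr0.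
rewrite dim_ann // ?vset_top //; congr (_ * _).
rewrite sj; have -> : (i + j = (i - j) + j.*2)%N by lia.
by rewrite exprD -mul2n exprM sqrrN !expr1n mulr1.
Qed.

End FaceNumbers.

(** * Face numbers against Betti numbers of a Buchsbaum poset *)

Section Main.
Variables (k : idomainType) (d : Order.disp_t) (S : finBPOrderType d).
Variables (hS : simplicial_poset S) (n : nat).
Hypotheses (hn : poset_dim hS = n%:Z - 1) (hB : buchsbaum hS k).

Let K : fieldType := {fraction {poly k}}.

Lemma max_face_card : (\max_(x : S) face_card hS x)%N = n.
Proof. by move/addIr: hn => []. Qed.

Lemma verts_leq (x : S) : (#|verts x| <= n)%N.
Proof. by rewrite (card_verts hS) -max_face_card; exact: leq_bigmax. Qed.

Lemma up_bot : up (\bot%O : S) = [set: S] :\ \bot%O.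
Proof. by apply/setP => x; rewrite !inE andbT lt0x. Qed.

Lemma link_acyclic_frac a j (z : {set S} -> K^o) :
  a != \bot%O -> (j + #|verts a| < n)%N ->
  (forall s, z s != 0 -> s \in order_complex (up a) /\ #|s| = j) ->
  (forall t, t \in order_complex (up a) -> bd z t = 0) ->
  exists2 y : {set S} -> K^o,
    (forall s, y s != 0 -> s \in order_complex (up a) /\ #|s| = j.+1) &
    forall t, t \in order_complex (up a) -> bd y t = z t.
Proof.
move=> a0 jn zP dz; have la : link a :\ a = up a.
  by apply/setP => x; rewrite !inE lt_neqAle eq_sym.
have hv : homology_vanishes K (link a :\ a) (j%:Z - 1).
  apply: homology_vanishes_frac; apply: hB => //.
  by rewrite hn -(card_verts hS); lia.
rewrite la in hv; have [|c cA dc] := hv (finfun z).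
  apply/is_cycleP/cyclesP; split.
    by apply/chainsP => s; rewrite ffunE; exact: zP.
  apply/ffunP => t; rewrite !ffunE.
  have -> : bd (finfun z) t = bd z t by apply: eq_bd => x _; rewrite ffunE.
  have [tA|tA] := boolP (t \in order_complex (up a)); first exact: dz.
  apply: bd_eq0 => x xt; apply/eqP; apply: contraNT tA => /zP[xtA _].
  by apply: order_complexS xtA; exact: subsetUr.
exists c => [s|t tA]; first by move/is_chainP1/chainsP: cA => /(_ s).
by rewrite -boundaryE dc ffunE.
Qed.

(** Distinct powers of the variable are distinct however small k is; this is the reason for working
    with rational functions. *)
Definition point (x : S) : K := FracField.tofrac 'X^(enum_rank x).

Lemma point_inj : injective point.
Proof.
move=> x y /eqP; rewrite tofrac_eq => /eqP/(congr1 (fun p : {poly k} => size p)).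
by rewrite !size_polyXn => -[/val_inj/enum_rank_inj].
Qed.

Lemma exactness_frac r j (z : {set S} -> ext K n r) :
  (j + r <= n)%N -> supported (up \bot%O) (@vset _ S) j set0 z ->
  (forall s, bd z s \in ann n point r (vset s)) ->
  exists2 y : {set S} -> ext K n r, supported (up \bot%O) (@vset _ S) j.+1 set0 y &
    forall s, z s - bd y s \in ann n point r (vset s).
Proof.
move=> jr zP dz.
have starE (W s : {set S}) : star \bot%O W s = (s \in order_complex (up \bot%O)) && (W \subset vset s).
  by rewrite /star verts0 set0U.
have base (W : {set S}) j' (z' : {set S} -> K^o) : W != set0 -> (j' < n)%N ->
    supported (up \bot%O) (@vset _ S) j' W z' ->
    (forall t, t \in order_complex (up \bot%O) -> W \subset vset t -> bd z' t = 0) ->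
    exists2 y : {set S} -> K^o, supported (up \bot%O) (@vset _ S) j'.+1 W y &
      forall t, t \in order_complex (up \bot%O) -> W \subset vset t -> bd y t = z' t.
  move=> W0 jn zP' dz'; have [||s||y yP dy] := star_acyclic hS link_acyclic_frac
      (a := \bot%O) (W := W) (j := j') (z := z') _ W0.
  - by rewrite verts0 sub0set.
  - by rewrite verts0 cards0 addn0.
  - by move=> /zP'[sA sj Ws]; rewrite starE sA.
  - by move=> t; rewrite starE => /andP[]; exact: dz'.
  exists y => [s /yP[]|t tA Wt]; first by rewrite starE => /andP[].
  by apply: dy; rewrite starE tA.
have card_vset (s : {set S}) : s \in order_complex (up \bot%O) -> (#|vset s| <= n)%N.
  by move=> sO; rewrite (vset_top hS sO); exact: verts_leq.
have [|y yP zy] := ann_exact point_inj (@vsetS _ S) card_vset base (U := setT) jr zP.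
  by move=> s; rewrite setTI.
by exists y => // s; have := zy s; rewrite setTI.
Qed.

Lemma poset_betti_dim j r :
  ((\dim (cycles (ext K n r) (up (\bot%O : S)) j))%:Z
    - (\dim (bounds (ext K n r) (up (\bot%O : S)) j))%:Z)
  = 'C(n, r)%:Z * (poset_betti S k (j%:Z - 1))%:Z.
Proof.
rewrite (dim_coords (@coords_cycles K (ext K n r) d S (up \bot%O) j)).
rewrite (dim_coords (@coords_bounds K (ext K n r) d S (up \bot%O) j)).
rewrite dim_ext /poset_betti -up_bot -betti_dim mulnDr PoszD addrK.
by rewrite PoszM.
Qed.

Lemma h_num_betti i : (i <= n)%N -> exists m : nat,
  h_num hS n i = 'C(n, i)%:Z *
    \sum_(0 <= j < i.+1) (-1) ^+ (i - j) * (poset_betti S k (j%:Z - 1))%:Z + m%:Z.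
Proof.
move=> ni; exists (kappa n point (up \bot%O) (@vset _ S) (n - i) i).
rewrite (h_num_ann hS verts_leq point_inj ni) alternating_ann_chains; last first.
- by rewrite subnKC.
- exact: exactness_frac.
- exact: vsetS.
congr (_ + _); rewrite big_mkord mulr_sumr; apply: eq_bigr => j _.
by rewrite poset_betti_dim bin_sub // mulrCA.
Qed.

(** The empty simplex is the boundary of any vertex of the order complex, and n > 0 provides one. *)
Lemma poset_betti_minus1 : (0 < n)%N -> poset_betti S k (-1) = 0%N.
Proof.
move=> n0; have [x x0] : exists x : S, x != \bot%O.
  apply: contrapT => nex; move: n0; rewrite -max_face_card lt0n => /negP[].
  rewrite -leqn0; apply/bigmax_leqP => x _; rewrite -(card_verts hS) leqn0 cards_eq0.
  by rewrite (verts_eq0 hS); apply: contrapT => /negP x0; apply: nex; exists x.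
have := betti_dim k (up (\bot%O : S)) 0; rewrite add0r up_bot -/(poset_betti S k (-1)).
suff -> : \dim (cycles K^o ([set: S] :\ \bot%O) 0) = \dim (bounds K^o ([set: S] :\ \bot%O) 0).
  by move/eqP; rewrite -[X in _ == X]add0n eqn_add2r => /eqP.
apply/eqP; rewrite eqn_leq; apply/andP; split; apply: dimvS; last exact: bounds_cycles.
apply/subvP => c /cyclesP[/chainsP cA _]; apply/boundsP.
exists [ffun s => if s == [set x] then c set0 else 0].
  apply/chainsP => s; rewrite ffunE; case: (s =P [set x]) => [-> _|_]; last by rewrite eqxx.
  rewrite cards1 inE sub1set !inE x0; split=> //.
  apply/forall_inP => y; rewrite inE => /eqP->.
  by apply/forall_inP => w; rewrite inE => /eqP->; rewrite lexx.
apply/ffunP => t; rewrite ffunE; have [->|t0] := eqVneq t set0.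
  rewrite /bd (bigD1 x) ?inE //= setU0 ffunE eqxx big1 ?addr0 => [|y /andP[_ yx]].
    by rewrite (_ : position set0 x = 0%N) ?scale1r //; apply: eq_card0 => y; rewrite !inE.
  by rewrite setU0 ffunE (inj_eq set1_inj) (negPf yx) scaler0.
rewrite bd_eq0 => [|y yt]; last first.
  rewrite ffunE; case: eqP => // e; case/negP: t0; rewrite -cards_eq0.
  by have := congr1 (fun s : {set S} => #|s|) e; rewrite cardsU1 yt cards1 add1n => -[->].
by apply/eqP/contraT => /cA[_ /eqP]; rewrite cards_eq0 (negPf t0).
Qed.

Lemma h_second_ge0 i : (i <= n)%N -> 0 <= h_second hS k n i.
Proof.
move=> ni; have [m hm] := h_num_betti ni.
have -> : h_second hS k n i = h_prime hS k n i -
    (if i == n then 0 else 'C(n, i)%:Z * (poset_betti S k (i%:Z - 1))%:Z).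
  by rewrite /h_second; case: eqP => [->|]; rewrite ?subr0.
rewrite /h_prime hm; case: i ni {hm} => [|i] ni.
  rewrite big_nat1 expr0 mul1r big_geq // mulr0 addr0 bin0 mul1r.
  by case: eqP => _; lia.
have b0 : poset_betti S k (0%:Z - 1) = 0%N by rewrite add0r poset_betti_minus1 //; lia.
rewrite big_nat_recr //= big_ltn // b0 mulr0 add0r subnn expr0 mul1r.
have -> : \sum_(1 <= j < i.+1) (-1) ^+ (i.+1 - j) * (poset_betti S k (j%:Z - 1))%:Z =
   - \sum_(1 <= j < i.+1) (-1) ^+ (i.+1 - j - 1) * (poset_betti S k (j%:Z - 1))%:Z.
  rewrite -sumrN !big_nat; apply: eq_bigr => j /andP[_ ji].
  rewrite [in LHS](_ : (i.+1 - j = (i.+1 - j - 1).+1)%N); last by lia.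
  by rewrite exprS mulN1r mulNr.
set s := \sum_(1 <= j < i.+1) _; rewrite mulrDr mulrN.
(* The last Betti term: it cancels when [i.+1 < n], leaving m, and is kept when [i.+1 = n], where
   its being nonnegative is enough. *)
set b := 'C(n, i.+1)%:Z * (poset_betti S k (i.+1%:Z - 1))%:Z.
have b_ge0 : 0 <= b by apply: mulr_ge0.
by case: eqP => _; lia.
Qed.

End Main.

Theorem corollary4 (k : idomainType)
    (hk : (forall x : k, x != 0 -> x \is a GRing.unit) \/
          (exists f : {rmorphism int -> k}, bijective f))
    (d : Order.disp_t) (S : finBPOrderType d) (hS : simplicial_poset S)
    (n : nat) (hn : poset_dim hS = n%:Z - 1) (hB : buchsbaum hS k)
    (i : nat) (hi : (i <= n)%N) :
  0 <= h_second hS k n i.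
Proof. exact: h_second_ge0. Qed.
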